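(* Let $n\ge2$ and let $\theta_n$ be the empirical correlation of two independent Gaussian random walks of length $n$. The second moment of $\theta_n$ is $$\begin{aligned}E(\theta_n^2)={}&-\frac14\int_0^\infty\int_0^\infty\frac{(s_{11}+2n)(s_{22}+2n)+4n^2}{\left[s_{11}s_{22}(s_{11}+4n)(s_{22}+4n)\right]^{3/4}}\left[f(s_{11}/n)^n-f(s_{11}/n)^{-n}\right]^{-1/2}\\&\qquad\times\left[f(s_{22}/n)^n-f(s_{22}/n)^{-n}\right]^{-1/2}\,ds_{11}\,ds_{22}\\&+\frac14\int_0^\infty\int_0^\infty\Bigg\{\frac{n(s_{11}+s_{22}+4n)}{\sqrt{s_{11}^2+4ns_{11}}+\sqrt{s_{22}^2+4ns_{22}}}\cdot\left[f(s_{11}/n)^nf(s_{22}/n)^n-f(s_{11}/n)^{-n}f(s_{22}/n)^{-n}\right]\\&\qquad+\frac12\left(\sqrt{s_{11}^2+4ns_{11}}+\sqrt{s_{22}^2+4ns_{22}}+s_{11}+s_{22}+4n\right)\\&\qquad\quad\cdot\frac{f(s_{11}/n)^nf(s_{22}/n)^{-n}-f(s_{22}/n)^nf(s_{11}/n)^{-n}}{f(s_{11}/n)-f(s_{22}/n)}\Bigg\}\cdot\left[f(s_{11}/n)^n-f(s_{11}/n)^{-n}\right]^{-3/2}\\&\qquad\cdot\left[f(s_{22}/n)^n-f(s_{22}/n)^{-n}\right]^{-3/2}\cdot\left[s_{11}s_{22}(s_{11}+4n)(s_{22}+4n)\right]^{-1/4}\,ds_{11}\,ds_{22},\end{aligned}$$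 where $$f(\lambda):=\frac{(\lambda+2)+\sqrt{(\lambda+2)^2-4}}{2}.$$
   Context: $\{X_k\}_{k\ge1}$ and $\{Y_k\}_{k\ge1}$ are two independent sequences of independent standard Gaussian random variables; $S_i=\sum_{j=1}^i X_j$ and $T_i=\sum_{j=1}^i Y_j$. The empirical correlation of the two random walks is $$\theta_n=\frac{\frac1n\sum_{i=1}^nS_iT_i-\frac1{n^2}\left(\sum_{i=1}^nS_i\right)\left(\sum_{i=1}^nT_i\right)}{\sqrt{\frac1n\sum_{i=1}^nS_i^2-\frac1{n^2}\left(\sum_{i=1}^nS_i\right)^2}\sqrt{\frac1n\sum_{i=1}^nT_i^2-\frac1{n^2}\left(\sum_{i=1}^nT_i\right)^2}}.$$
   Formalization: The two double integrals each diverge to +∞ (the integrands behave like 1/(2 s11 s22) near the origin), so their difference is undefined; the formula is proved with the two integrands, weighted −1/4 and +1/4, combined under a single double integral. *)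

(* Defs.v *)
From HB Require Import structures.
From mathcomp Require Import all_boot all_order all_algebra.
From mathcomp Require Import finmap.
From mathcomp Require Import all_classical all_reals all_analysis.

Set Implicit Arguments.
Unset Strict Implicit.
Unset Printing Implicit Defensive.

Import Order.TTheory GRing.Theory Num.Theory.
Import numFieldNormedType.Exports.

Local Open Scope classical_set_scope.
Local Open Scope ring_scope.

Definition mutually_independent (d : measure_display) (T : measurableType d)
    (R : realType) (P : probability T R) (X : nat -> {RV P >-> R}) : Prop :=
  forall (J : {fset nat}) (A : nat -> set R),
    (forall i, measurable (A i)) ->
    P (\bigcap_(i in [set` J]) (X i @^-1` A i)) =
    (\prod_(i <- J) P (X i @^-1` A i))%E.

Definition sigma_of_sequence (d : measure_display) (T : measurableType d)
    (R : realType) (P : probability T R) (X : nat -> {RV P >-> R}) :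
    set (set T) :=
  <<s \bigcup_k preimage_set_system [set: T] (X k) measurable >>.

Definition independent_sequences (d : measure_display) (T : measurableType d)
    (R : realType) (P : probability T R) (X Y : nat -> {RV P >-> R}) : Prop :=
  forall A B : set T, sigma_of_sequence X A -> sigma_of_sequence Y B ->
    P (A `&` B) = (P A * P B)%E.

Definition standard_gaussian (d : measure_display) (T : measurableType d)
    (R : realType) (P : probability T R) (Z : {RV P >-> R}) : Prop :=
  forall A : set R, measurable A -> distribution P Z A = normal_prob 0 1 A.

(* Sequences are indexed from 0: X k is the (k+1)-st increment, so that
   walk X i is the sum of the first i increments. *)
Definition walk (T : Type) (R : realType) (X : nat -> T -> R) (i : nat) (w : T)
    : R :=
  \sum_(j < i) X j w.

Definition empirical_cov (R : realType) (n : nat) (u v : nat -> R) : R :=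
  n%:R^-1 * \sum_(1 <= i < n.+1) u i * v i
  - (n%:R ^+ 2)^-1 * (\sum_(1 <= i < n.+1) u i) * (\sum_(1 <= i < n.+1) v i).

Definition theta (T : Type) (R : realType) (X Y : nat -> T -> R) (n : nat)
    (w : T) : R :=
  let S i := walk X i w in
  let U i := walk Y i w in
  empirical_cov n S U
  / (Num.sqrt (empirical_cov n S S) * Num.sqrt (empirical_cov n U U)).

Definition f (R : realType) (x : R) : R :=
  ((x + 2) + Num.sqrt ((x + 2) ^+ 2 - 4)) / 2.

Definition integrand1 (R : realType) (n : nat) (s11 s22 : R) : R :=
  let N : R := n%:R in
  let f1 := f (s11 / N) in
  let f2 := f (s22 / N) in
  ((s11 + 2 * N) * (s22 + 2 * N) + 4 * N ^+ 2)
  / (s11 * s22 * (s11 + 4 * N) * (s22 + 4 * N)) `^ (3 / 4)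
  * (f1 ^+ n - f1 ^- n) `^ (- (1 / 2))
  * (f2 ^+ n - f2 ^- n) `^ (- (1 / 2)).

(* The quotient by f1 - f2 has a removable singularity on the diagonal
   s11 = s22, a null set, where division by zero makes it 0 here. *)
Definition integrand2 (R : realType) (n : nat) (s11 s22 : R) : R :=
  let N : R := n%:R in
  let f1 := f (s11 / N) in
  let f2 := f (s22 / N) in
  let r1 := Num.sqrt (s11 ^+ 2 + 4 * N * s11) in
  let r2 := Num.sqrt (s22 ^+ 2 + 4 * N * s22) in
  (N * (s11 + s22 + 4 * N) / (r1 + r2)
     * (f1 ^+ n * f2 ^+ n - f1 ^- n * f2 ^- n)
   + 1 / 2 * (r1 + r2 + s11 + s22 + 4 * N)
     * ((f1 ^+ n * f2 ^- n - f2 ^+ n * f1 ^- n) / (f1 - f2)))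
  * (f1 ^+ n - f1 ^- n) `^ (- (3 / 2))
  * (f2 ^+ n - f2 ^- n) `^ (- (3 / 2))
  * (s11 * s22 * (s11 + 4 * N) * (s22 + 4 * N)) `^ (- (1 / 4)).

(* integrand1 and integrand2 are both equivalent to 1 / (2 * s11 * s22) at the
   origin, so each has integral +oo over the quadrant, and the difference
   - 1/4 \int integrand1 + 1/4 \int integrand2 only makes sense as the integral
   of the difference, which is Lebesgue integrable. *)
Definition second_moment_integrand (R : realType) (n : nat) (s11 s22 : R) : R :=
  - (1 / 4) * integrand1 n s11 s22 + 1 / 4 * integrand2 n s11 s22.

(* Main.v *)
(**
  Both empirical variances and the empirical covariance are values of one
  bilinear form [K] on the increments: [K] is the Green matrix of the discrete
  Dirichlet Laplacian (the covariance of a Brownian bridge on the grid), so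
  [theta ^+ 2 = B(X, Y) ^+ 2 / (Q X * Q Y)]. Writing
  [2 / Q = \int_0^oo expR (- (s / 2 * Q)) ds] twice and using Tonelli and the
  independence of [X] and [Y], the second moment becomes
  [4^-1 * \int\int \tr (K *m M s *m (K *m M t))], where [M s] is the matrix of
  the moments [E (x_j * x_k * expR (- (s / 2 * Q)))].

  Gaussian integration by parts gives [(1 + s K) *m M s = phi s * 1], where
  [phi s = E (expR (- (s / 2 * Q)))], so [K *m M s] is [phi s] times the
  resolvent [H s = K (1 + s K)^-1]. With [y = f (s / n)], the matrix [H s] is
  again a Green matrix and its trace is explicit in [y]; then
  [phi' = - 2^-1 * \tr (H s) * phi] integrates, in the variable [y], to
  [phi ^+ 2 * (y ^+ n - y ^- n) / (n * (y - y^-1)) = 1]. The resolvent identity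
  [(t - s) * \tr (H s *m H t) = \tr (H s) - \tr (H t)] turns the double
  integral into the announced one off the diagonal [s = t].
*)
Require Import Defs.
From HB Require Import structures.
From mathcomp Require Import all_boot all_order all_algebra.
From mathcomp Require Import ring lra zify.
From mathcomp Require Import finmap.
From mathcomp Require Import all_classical all_reals all_analysis.
From mathcomp Require Import measurable_realfun.

Set Implicit Arguments.
Unset Strict Implicit.
Unset Printing Implicit Defensive.

Import Order.TTheory GRing.Theory Num.Theory.
Import numFieldNormedType.Exports.

Local Open Scope classical_set_scope.
Local Open Scope ring_scope.

(** * The random-walk covariance matrix and its resolvent *)

Section GreenMatrix.
Context {F : fieldType}.

(** Two obstacles shape the proof. The two announced integrands are not separately integrable, so
    every exchange of integrals is made on one nonnegative kernel, and the formula enters only as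
    the value of its integral over the sample space at each [(s, t)]. The increments are known
    through independence of events, so neither a joint density nor a determinant is used:
    integration by parts runs in one coordinate with the others frozen, and the linear system it
    gives for the moments replaces an explicit Gaussian integral. The substitution
    [y + y^-1 = 2 + s / n] comes from the inverse of the covariance matrix, which is [n] times the
    tridiagonal matrix with diagonal 2. Adding [s] changes that diagonal to [y + y^-1], and the
    associated recurrence has the solutions [y ^+ j] and [y ^- j]. Where an empirical variance
    vanishes, so does the empirical covariance. The convention that division by 0 gives 0 then
    agrees with the kernel, which is 0 there, and no exceptional event has to be removed. *)

Definition green (u : nat -> F) (n p q : nat) : F :=
  u (minn p q) * u (n - maxn p q)%N.

Definition green_mx (m : nat) (u : nat -> F) (c : F) : 'M[F]_m :=
  \matrix_(j, k) (green u m.+1 j.+1 k.+1 / c).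

(* Minus the discrete Laplacian with Dirichlet conditions when [a = 2]. *)
Definition tridiag_mx (m : nat) (a : F) : 'M[F]_m :=
  \matrix_(j, k) (a *+ (j == k) - ((j.+1 == k) + (k.+1 == j))%:R).

Lemma sum_delta_ord (m i : nat) (h : nat -> F) :
  \sum_(l < m) (l == i :> nat)%:R * h l = if (i < m)%N then h i else 0.
Proof.
case: ltnP => im.
  rewrite (bigD1 (Ordinal im)) //= eqxx mul1r big1 ?addr0 // => j /eqP jn.
  by case: eqP => [ji|]; rewrite ?mul0r //; case: jn; apply: val_inj.
rewrite big1 // => j _; case: eqP => [ji|]; rewrite ?mul0r //.
by move: (ltn_ord j); rewrite ji ltnNge im.
Qed.

(** The zero boundary values stand for the missing neighbours of the first and last rows, so one
    formula serves all rows. *)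
Lemma sum_tridiag_mx (m : nat) (a : F) (h : nat -> F) (j : 'I_m) :
  h 0%N = 0 -> h m.+1 = 0 ->
  \sum_(l < m) tridiag_mx m a j l * h l.+1 = a * h j.+1 - h j.+2 - h j.
Proof.
move=> h0 hm.
transitivity (a * (\sum_(l < m) (l == j :> nat)%:R * h l.+1)
  - \sum_(l < m) (l == j.+1 :> nat)%:R * h l.+1
  - \sum_(l < m) (l.+1 == j :> nat)%:R * h l.+1).
  rewrite mulr_sumr -!sumrB; apply: eq_bigr => l _.
  rewrite mxE -mulr_natr natrD (eq_sym j l) (eq_sym j.+1 l) -(inj_eq val_inj) /=.
  ring.
rewrite (@sum_delta_ord m j (fun l => h l.+1)) ltn_ord.
rewrite (@sum_delta_ord m j.+1 (fun l => h l.+1)).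
have -> : (if (j.+1 < m)%N then h j.+2 else 0) = h j.+2.
  case: ltnP => // mj.
  by have -> : j.+2 = m.+1 by move: (ltn_ord j); lia.
congr (_ - _ - _).
case: j => -[|j] jm /=.
  by rewrite big1 // => l _; rewrite mul0r.
by rewrite (@sum_delta_ord m j (fun l => h l.+1)) (ltn_trans (ltnSn j) jm).
Qed.

Section Recurrence.
Variables (a : F) (u : nat -> F).
Hypothesis u0 : u 0%N = 0.
Hypothesis uSS : forall j, u j.+2 = a * u j.+1 - u j.

(** Discrete Wronskian. By the recurrence the left side does not change when one step is moved from
    [k] to [j], so it depends on [j + k] alone and can be read off at [j = 0]. *)
Lemma casoratian j k : u j.+1 * u k.+1 - u j * u k = u 1%N * u (j + k).+1.
Proof.
elim: j k => [|j IHj] k; first by rewrite u0; ring.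
rewrite addSnnS -IHj !uSS; ring.
Qed.

(** Away from the diagonal a column of the Green matrix solves the recurrence on either side and the
    product vanishes. On the diagonal the two branches meet, and the defect is the Casoratian. *)
Lemma tridiag_green_mx (m : nat) (c : F) :
  tridiag_mx m a *m green_mx m u c = (u 1%N * u m.+1 / c)%:M.
Proof.
apply/matrixP => j k; rewrite mxE.
transitivity ((\sum_(l < m) tridiag_mx m a j l * green u m.+1 l.+1 k.+1) / c).
  by rewrite mulr_suml; apply: eq_bigr => l _; rewrite [green_mx _ _ _ _ _]mxE mulrA.
rewrite (@sum_tridiag_mx m a (fun l => green u m.+1 l k.+1) j); last 2 first.
- by rewrite /green min0n u0 mul0r.
- by rewrite /green (maxn_idPl _) ?subnn ?u0 ?mulr0 // ltnS ltnW // ltn_ord.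
rewrite !mxE -mulr_natr mulrAC; congr (_ / _).
have jm := ltn_ord j; have km := ltn_ord k.
rewrite /green -(inj_eq val_inj) /=; case: (ltngtP j k) => jk.
- rewrite mulr0 !(minn_idPl _) ?(maxn_idPr _) //; try lia.
  rewrite uSS; ring.
- rewrite mulr0 !(minn_idPr _) ?(maxn_idPl _) //; try lia.
  have -> : (m.+1 - j = (m.+1 - j.+2).+2)%N by lia.
  have -> : (m.+1 - j.+1 = (m.+1 - j.+2).+1)%N by lia.
  rewrite uSS; ring.
- rewrite -jk minnn maxnn mulr1 (minn_idPr _) ?leqnSn // (maxn_idPl _) //.
  rewrite (minn_idPl _) ?leqnSn // (maxn_idPr _) //.
  have -> : (u m.+1 = u (j.+1 + (m.+1 - j.+2)).+1) by congr u; lia.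
  have -> : (m.+1 - j.+1 = (m.+1 - j.+2).+1)%N by lia.
  rewrite -casoratian uSS; ring.
Qed.

End Recurrence.

Lemma tridiag_mxD (m : nat) (a b : F) :
  tridiag_mx m (a + b) = tridiag_mx m a + b%:M.
Proof. by apply/matrixP => j k; rewrite !mxE mulrnDl; ring. Qed.

End GreenMatrix.

(** * Resolvents, characterized by [(1 + s K) H = K] *)

Section Resolvent.
Context {F : fieldType} {m : nat}.
Implicit Types (K H : 'M[F]_m) (s t : F).

Lemma resolvent_of_inverse (K T H : 'M[F]_m) (s : F) :
  T *m K = 1%:M -> (T + s%:M) *m H = 1%:M -> (1%:M + s *: K) *m H = K.
Proof.
move=> TK TsH; have KT := mulmx1C TK.
have : K *m ((T + s%:M) *m H) = K by rewrite TsH mulmx1.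
by rewrite mulmxA mulmxDr KT mul_mx_scalar.
Qed.

(** The inverse is [1 - s H]. *)
Lemma resolvent_unitmx (K H : 'M[F]_m) (s : F) :
  (1%:M + s *: K) *m H = K -> 1%:M + s *: K \in unitmx.
Proof.
move=> AH.
suff /mulmx1_unit[] : (1%:M + s *: K) *m (1%:M - s *: H) = 1%:M by [].
by rewrite mulmxBr mulmx1 -scalemxAr AH addrK.
Qed.

Lemma resolvent_mulmx (K H M : 'M[F]_m) (s c : F) :
  (1%:M + s *: K) *m H = K -> (1%:M + s *: K) *m M = c%:M -> K *m M = c *: H.
Proof.
move=> AH AM; have uA := resolvent_unitmx AH.
apply: (can_inj (mulKmx uA)); rewrite -scalemxAr AH mulmxA.
have -> : (1%:M + s *: K) *m K = K *m (1%:M + s *: K).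
  by rewrite mulmxDr mulmxDl mulmx1 mul1mx -scalemxAl -scalemxAr.
by rewrite -mulmxA AM mul_mx_scalar.
Qed.

(** With [A = 1 + s K] and [B = 1 + t K], which commute with [K], multiplying [H1 - H2] by [A] on
    the left and [B] on the right gives [K B - A K = (t - s) K K], the same as for
    [(t - s) H1 H2]. *)
Lemma resolvent_trace (K H1 H2 : 'M[F]_m) (s t : F) :
  (1%:M + s *: K) *m H1 = K -> (1%:M + t *: K) *m H2 = K ->
  (t - s) * \tr (H1 *m H2) = \tr H1 - \tr H2.
Proof.
set A := 1%:M + s *: K; set B := 1%:M + t *: K => AH BH.
have uA := resolvent_unitmx AH; have uB := resolvent_unitmx BH.
have KA : K *m A = A *m K.
  by rewrite mulmxDr mulmxDl mulmx1 mul1mx -scalemxAl -scalemxAr.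
have KB : K *m B = B *m K.
  by rewrite mulmxDr mulmxDl mulmx1 mul1mx -scalemxAl -scalemxAr.
have HB : H2 *m B = K.
  by apply: (can_inj (mulKmx uB)); rewrite mulmxA BH KB.
rewrite -mxtraceZ -raddfB /=; congr mxtrace.
apply: (can_inj (mulKmx uA)); apply: (can_inj (mulmxK uB)).
have -> : A *m ((t - s) *: (H1 *m H2)) *m B = (t - s) *: (K *m K).
  by rewrite -scalemxAr -scalemxAl (mulmxA A) AH -mulmxA HB.
have -> : A *m (H1 - H2) *m B = K *m B - A *m K.
  by rewrite mulmxBr mulmxBl AH -(mulmxA A H2) HB.
rewrite KB -mulmxBl scalemxAl; congr (_ *m _).
by rewrite /A /B opprD addrACA subrr add0r -scalerBl.
Qed.

End Resolvent.

(** * Hyperbolic identities written with powers *)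

Section PowerDifferences.
Context {F : fieldType}.
Implicit Types y : F.

(** For [y = expR x] this is [2 sinh (k x)], and [powsum] is [2 cosh (k x)]. *)
Definition powdiff y (k : nat) : F := y ^+ k - y ^- k.

Definition powsum y (k : nat) : F := y ^+ k + y ^- k.

Lemma powdiff0 y : powdiff y 0 = 0.
Proof. by rewrite /powdiff expr0 invr1 subrr. Qed.

Lemma powdiffSS y j : y != 0 ->
  powdiff y j.+2 = (y + y^-1) * powdiff y j.+1 - powdiff y j.
Proof.
move=> y0; rewrite /powdiff -!exprVn !exprS; field.
by rewrite y0 ?expf_neq0.
Qed.

(** The terms are [y] to the power [n - 2 j - 2]; multiplying by [y - y^-1] turns each into a
    difference of two powers whose exponents differ by 2. *)
Lemma telescope_powers y (n k : nat) : y != 0 -> (k < n)%N ->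
  powdiff y 1 * (\sum_(j < k) y ^+ (n - j.+1) * y ^- j.+1) =
  y ^+ n.-1 - y ^+ (n - k) * y ^- k.+1.
Proof.
move=> y0; elim: k => [|k IHk] kn.
  rewrite big_ord0 mulr0 subn0 -[in X in _ - X](ltn_predK kn) exprS expr1.
  by field.
rewrite big_ord_recr mulrDr /= (IHk (ltnW kn)) /powdiff expr1.
have -> : (n - k = (n - k.+1).+1)%N by lia.
rewrite !exprS; have := expf_neq0 k y0.
move: (y ^+ (n - k.+1)) (y ^+ k) (y ^+ n.-1) => p q r q0.
by field; rewrite y0 q0.
Qed.

(** As for a product of two hyperbolic sines, each term is [powsum y m.+1] minus a power of [y] and
    its inverse. The two leftover sums are the telescoping sum at [y] and at [y^-1]. *)
Lemma sum_powdiff y (m : nat) : y != 0 ->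
  powdiff y 1 * (\sum_(j < m) powdiff y j.+1 * powdiff y (m - j)) =
  m.+1%:R * powsum y m.+1 * powdiff y 1 - powdiff y m.+1 * powsum y 1.
Proof.
move=> y0.
have E : \sum_(j < m) powdiff y j.+1 * powdiff y (m - j) =
  m%:R * powsum y m.+1 - \sum_(j < m) y ^+ (m.+1 - j.+1) * y ^- j.+1
  - \sum_(j < m) (y^-1) ^+ (m.+1 - j.+1) * (y^-1) ^- j.+1.
  rewrite mulr_natl -[in X in _ *+ X](card_ord m) -sumr_const -!sumrB.
  apply: eq_bigr => j _; rewrite subSS /powdiff /powsum !exprVn invrK.
  have -> : m.+1 = (j.+1 + (m - j))%N by move: (ltn_ord j); lia.
  rewrite exprD; have := expf_neq0 j.+1 y0; have := expf_neq0 (m - j) y0.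
  move: (y ^+ (m - j)) (y ^+ j.+1) => p q p0 q0.
  by field; rewrite p0 q0.
have Vn : powdiff y^-1 1 = - powdiff y 1.
  by rewrite /powdiff !expr1 invrK opprB.
have Vy0 : y^-1 != 0 by rewrite invr_eq0.
have := telescope_powers y0 (ltnSn m); have := telescope_powers Vy0 (ltnSn m).
rewrite Vn mulNr => /eqP; rewrite eqr_oppLR => /eqP T2 T1.
rewrite E !mulrBr T1 T2 subSnn /= !exprVn invrK.
rewrite /powdiff /powsum -[m.+1%:R]natr1 !exprS !expr0.
have := expf_neq0 m y0; move: (y ^+ m) => p p0.
by field; rewrite y0 p0.
Qed.

(* The quotient of [powdiff y n] by [n * powdiff y 1], extended to [y = 1]. *)
Definition mean_power y (n : nat) : F :=
  n%:R^-1 * \sum_(k < n) y ^+ (n.-1 - k) * y^-1 ^+ k.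

Lemma mean_powerE y (n : nat) : y != 0 -> n%:R != 0 :> F ->
  powdiff y 1 * mean_power y n = n%:R^-1 * powdiff y n.
Proof.
move=> y0 n0; rewrite /mean_power mulrCA; congr (_ * _).
case: n {n0} => [|n]; first by rewrite big_ord0 mulr0 powdiff0.
rewrite [RHS]/powdiff -[y ^- n.+1]exprVn subrXX /powdiff expr1.
by congr (_ * _); apply: eq_bigr => i _; rewrite subSS.
Qed.

Lemma mean_power1 (n : nat) : n%:R != 0 :> F -> mean_power 1 n = 1.
Proof.
move=> n0; rewrite /mean_power (eq_bigr (fun=> 1)) => [|i _].
  by rewrite sumr_const card_ord mulVf.
by rewrite invr1 !expr1n mulr1.
Qed.

End PowerDifferences.

Section WalkGreen.
Context {F : fieldType} (m : nat).
Implicit Types y : F.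
Hypothesis char0 : m.+1%:R != 0 :> F.

(* Covariance matrix of a Brownian bridge at the times [j / n], for [n = m.+1]
   and [0 < j < n]. *)
Definition bridge_mx : 'M[F]_m := green_mx m (fun j => j%:R) (m.+1%:R ^+ 2).

(** The divisor makes this the inverse of [n] times [tridiag_mx m (y + y^-1)], where [n = m.+1]. *)
Definition bridge_resolvent y : 'M[F]_m :=
  green_mx m (powdiff y) (m.+1%:R * powdiff y 1 * powdiff y m.+1).

Lemma bridge_resolventE y : y != 0 -> powdiff y 1 != 0 -> powdiff y m.+1 != 0 ->
  (1%:M + (m.+1%:R * (y + y^-1 - 2)) *: bridge_mx) *m bridge_resolvent y
  = bridge_mx.
Proof.
move=> y0 u1 un.
apply: (@resolvent_of_inverse _ _ _ (m.+1%:R *: tridiag_mx m 2)).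
  (* At [a = 2] the recurrence is solved by [j] itself; this identifies the inverse of
     [bridge_mx]. *)
  rewrite -scalemxAl tridiag_green_mx => [|//|j].
    rewrite scale_scalar_mx; congr (_%:M).
    by move: m.+1%:R char0 => N N0; field.
  by rewrite -[j.+2]addn2 -[j.+1]addn1 !natrD; ring.
rewrite -scale_scalar_mx -scalerDr -tridiag_mxD -scalemxAl.
rewrite (_ : 2 + _ = y + y^-1); last by ring.
rewrite tridiag_green_mx => [||j]; rewrite ?powdiff0 //; last exact: powdiffSS.
rewrite scale_scalar_mx; congr (_%:M).
by move: m.+1%:R char0 => N N0; field; rewrite u1 un N0.
Qed.

Lemma bridge_resolvent_trace y : y != 0 -> powdiff y 1 != 0 ->
  powdiff y m.+1 != 0 ->
  \tr (bridge_resolvent y) =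
  powsum y m.+1 / (powdiff y 1 * powdiff y m.+1)
  - powsum y 1 / (m.+1%:R * powdiff y 1 ^+ 2).
Proof.
move=> y0 u1 un; rewrite /mxtrace.
transitivity ((\sum_(j < m) powdiff y j.+1 * powdiff y (m - j)) /
    (m.+1%:R * powdiff y 1 * powdiff y m.+1)).
  rewrite mulr_suml; apply: eq_bigr => j _.
  by rewrite mxE /green minnn maxnn subSS.
apply: (mulfI u1); rewrite mulrA sum_powdiff //.
by move: m.+1%:R char0 => N N0; field; rewrite u1 un N0.
Qed.

End WalkGreen.

(** * Gaussian integration by parts *)

Section NormalIntegral.
Context {R : realType}.
Local Notation mu := (@lebesgue_measure R).

(** The Radon-Nikodym derivative and [normal_pdf] have the same integral over every measurable set,
    hence agree almost everywhere. *)
Lemma ge0_integral_normal (m s : R) (f : R -> \bar R) :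
  measurable_fun [set: R] f -> (forall x, 0 <= f x)%E ->
  (\int[normal_prob m s]_x f x = \int[mu]_x (f x * (normal_pdf m s x)%:E))%E.
Proof.
move=> mf f0; have dom := @normal_prob_dominates R m s.
rewrite -(Radon_Nikodym_SigmaFinite.change_of_variables dom) //.
have iRN := Radon_Nikodym_SigmaFinite.f_integrable dom.
apply: ae_eq_integral => //.
- by apply: emeasurable_funM => //; exact: measurable_int iRN.
- apply: emeasurable_funM => //.
  by apply/measurable_EFinP; exact: measurable_normal_pdf.
- apply: ae_eqe_mul2l; apply: integral_ae_eq => //.
  + by apply/measurable_EFinP; exact: measurable_normal_pdf.
  + by move=> E _ mE; rewrite -Radon_Nikodym_SigmaFinite.f_integral.
Qed.

Lemma integral_normal (m s : R) (f : R -> \bar R) :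
  measurable_fun [set: R] f ->
  (\int[normal_prob m s]_x f x = \int[mu]_x (f x * (normal_pdf m s x)%:E))%E.
Proof.
move=> mf; rewrite [LHS]integralE [RHS]integralE.
rewrite !ge0_integral_normal //; [|exact: measurable_funeneg|exact: measurable_funepos].
have p0 x : (0 <= (normal_pdf m s x)%:E)%E by rewrite lee_fin normal_pdf_ge0.
congr (_ - _)%E; apply: eq_integral => x _.
- by rewrite !funeposE maxe_pMl // mul0e.
- by rewrite !funenegE maxe_pMl // mul0e mulNe.
Qed.

(** A Gaussian of variance 2 leaves a factor [expR (- v)], [v = x ^+ 2 / 4], to absorb the
    polynomial: what remains is [1 + 4 v <= 5 expR v], a consequence of [1 + v <= expR v]. *)
Let quad_gauss_le (x : R) :
  (1 + x ^+ 2) * normal_pdf 0 1 x <=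
  5 * normal_peak 1 * (normal_peak (Num.sqrt 2))^-1 * normal_pdf 0 (Num.sqrt 2) x.
Proof.
have s2 : Num.sqrt 2 != 0 :> R by rewrite gt_eqF // sqrtr_gt0.
rewrite !normal_pdfE ?oner_neq0 // /normal_fun !subr0 sqr_sqrtr // expr1n.
have p1 : 0 < normal_peak 1 :> R by rewrite normal_peak_gt0 ?oner_neq0.
have p2 := normal_peak_gt0 s2.
rewrite -!mulrA [X in _ <= 5 * (_ * X)]mulrA mulVf ?gt_eqF // mul1r.
rewrite mulrCA [X in _ <= X]mulrCA; apply: ler_wpM2l; first exact: ltW.
set v := x ^+ 2 / 4.
have -> : - x ^+ 2 / (1 *+ 2) = - v - v by rewrite /v -mulr_natr; field.
have -> : - x ^+ 2 / (2 *+ 2) = - v by rewrite /v -mulr_natr; field.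
have -> : x ^+ 2 = 4 * v by rewrite /v; field.
rewrite expRD mulrA; apply: ler_wpM2r; first exact: expR_ge0.
rewrite expRN ler_pdivrMr ?expR_gt0 //.
have v0 : 0 <= v by rewrite /v divr_ge0 ?sqr_ge0.
have := expR_ge1Dx v; set e := expR v; nra.
Qed.

Lemma integrable_quad_normal_pdf :
  mu.-integrable [set: R] (fun x => ((1 + x ^+ 2) * normal_pdf 0 1 x)%:E).
Proof.
have mpdf (m s : R) := @measurable_normal_pdf R m s.
pose c : R := 5 * normal_peak 1 * (normal_peak (Num.sqrt 2))^-1.
have ig : mu.-integrable [set: R]
    (fun x => (c%:E * (normal_pdf 0 (Num.sqrt 2) x)%:E)%E).
  by apply: integrableZl => //; exact: integrable_normal_pdf.
apply: (le_integrable measurableT _ _ ig).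
- apply/measurable_EFinP; apply: measurable_funM; last exact: mpdf.
  by apply: measurable_funD => //; exact: measurable_funX.
- move=> x _; rewrite -EFinM !abse_EFin lee_fin.
  apply: (le_trans _ (ler_norm _)); rewrite ger0_norm ?quad_gauss_le //.
  by rewrite mulr_ge0 ?normal_pdf_ge0 // addr_ge0 // sqr_ge0.
Qed.

End NormalIntegral.

(** * The Stein identity on the real line *)

Section Stein.
Context {R : realType}.
Local Notation mu := (@lebesgue_measure R).

Lemma integral_derivative_eq0 (F F' : R -> R) :
  (forall x : R, is_derive x 1 F (F' x)) -> continuous F' ->
  mu.-integrable [set: R] (EFin \o F') ->
  F n%:R @[n --> \oo] --> 0 -> F (- n%:R) @[n --> \oo] --> 0 ->
  (\int[mu]_x (F' x)%:E = 0)%E.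
Proof.
move=> dF cF' iF' F0 FN0.
have mF' : measurable_fun [set: R] F' by exact: continuous_measurable_fun.
(* The endpoints use [n.+1] so that the interval is nondegenerate, as the fundamental theorem of
   calculus requires. *)
pose I (n : nat) : set R := `[- n.+1%:R, n.+1%:R]%classic.
have cvgI : (\int[mu]_(x in I n) (F' x)%:E)%E @[n --> \oo] -->
    (\int[mu]_x (F' x)%:E)%E.
  under eq_cvg do rewrite integral_mkcond.
  apply: (@dominated_cvg _ _ _ mu _ measurableT 
    (fun n => (EFin \o F') \_ (I n)) (EFin \o F') (abse \o (EFin \o F'))).
  - move=> n; rewrite restrict_EFin; apply/measurable_EFinP.
    apply: (@measurable_restrictT _ _ _ _ (I n) F' (measurable_itv _)).1.
    exact: measurable_funTS.
  - move=> x _; apply: cvg_near_cst; near=> n.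
    rewrite patchE mem_set // /I /= in_itv /= -ler_norml.
    rewrite ltW // (@lt_le_trans _ _ n%:R) ?ler_nat //.
    by near: n; exact: nbhs_infty_gtr.
  - by [].
  - exact: integrable_abse.
  - by move=> n x _; rewrite patchE; case: ifP => // _; rewrite abse0 abse_ge0.
have cvg0 : (\int[mu]_(x in I n) (F' x)%:E)%E @[n --> \oo] --> 0%:E.
  have -> : (fun n => \int[mu]_(x in I n) (F' x)%:E)%E =
    (fun n => (F n.+1%:R - F (- n.+1%:R))%:E).
    apply/funext => n; rewrite (@continuous_FTC2 _ F' F) //.
    - by rewrite gtrN.
    - exact: continuous_subspaceT.
    - have cF : continuous F.
        by move=> x; apply/differentiable_continuous/derivable1_diffP; case: (dF x).
      split; first by move=> x _; case: (dF x).
      + by apply: cvg_at_right_filter; exact: cF.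
      + by apply: cvg_at_left_filter; exact: cF.
    - by move=> x _; rewrite derive1E; case: (dF x).
  apply: cvg_EFin; first exact: nearW.
  rewrite /comp /= -[X in _ --> X](subr0 0).
  by apply: cvgB; [move: F0|move: FN0]; rewrite -cvg_shiftS.
exact: (cvg_unique _ cvgI cvg0).
Unshelve. end_near. Qed.

Lemma is_derive_normal_pdf (x : R) :
  is_derive x 1 (normal_pdf 0 1) (- x * normal_pdf 0 1 x).
Proof.
rewrite normal_pdfE ?oner_neq0 //.
pose q (y : R) := - (2^-1) * y ^+ 2.
have -> : (fun y : R => normal_peak 1 * normal_fun 0 1 y) =
    (fun y : R => normal_peak 1 * (expR \o q) y).
  apply/funext => y; rewrite /normal_fun /q /= subr0 expr1n; congr (_ * expR _).
  by rewrite -mulr_natr; field.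
have dq : is_derive x 1 q (- x).
  by rewrite /q; apply: is_derive_eq; rewrite /GRing.scale /=; field.
have dc := is_derive1_comp (is_derive_expR (q x)) dq.
have -> : (fun y : R => normal_peak 1 * (expR \o q) y) =
  (fun y : R => normal_peak 1 *: (expR \o q) y) by [].
apply: is_derive_eq.
rewrite /GRing.scale /= [normal_fun 0 1 x](_ : _ = expR (q x)); first by ring.
rewrite /normal_fun /q /= subr0 expr1n; congr (expR _).
by rewrite -mulr_natr; field.
Qed.

(** The Gaussian density [p] satisfies [p' = - x p], so the integrand times [p] is the derivative of
    [h p]. The growth bounds make it integrable and make [h p] vanish at infinity. *)
Lemma integral_normal_stein (h h' : R -> R) (C : R) :
  (forall x : R, is_derive x 1 h (h' x)) -> continuous h' ->
  (forall x, `|h x| <= C * (1 + `|x|)) ->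
  (forall x, `|h' x| <= C * (1 + x ^+ 2)) ->
  (\int[normal_prob 0 1]_x (h' x - x * h x)%:E = 0)%E.
Proof.
move=> dh ch' hC h'C.
have C0 : 0 <= C by have := hC 0; rewrite normr0 addr0 mulr1; exact: le_trans.
have ch : continuous h.
  by move=> x; apply/differentiable_continuous/derivable1_diffP; case: (dh x).
have cp : continuous (normal_pdf 0 1 : R -> R).
  by apply: continuous_normal_pdf; rewrite oner_neq0.
have cG : continuous (fun x => h' x - x * h x).
  move=> x; apply: cvgB; first exact: ch'.
  by apply: cvgM; [exact: cvg_id|exact: ch].
rewrite integral_normal; last first.
  by apply/measurable_EFinP; exact: continuous_measurable_fun.
under eq_integral do rewrite -EFinM.
(* After clearing denominators this is [(1 + n)^2 <= 8 expR (n^2 / 2)], which follows from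
   [1 + v <= expR v]. *)
have pb (n : nat) (x : R) : `|x| = n%:R -> `|h x * normal_pdf 0 1 x| <=
    C * normal_peak 1 * 8 * harmonic n.
  move=> xn; rewrite normrM (ger0_norm (normal_pdf_ge0 _ _ _)).
  have := hC x; rewrite xn normal_pdfE ?oner_neq0 //.
  rewrite /normal_fun subr0 expr1n.
  set v := x ^+ 2 / 2.
  have -> : - x ^+ 2 / (1 *+ 2) = - v by rewrite /v -mulr_natr; field.
  have vn : v = n%:R ^+ 2 / 2 by rewrite /v -xn real_normK ?num_real.
  have := expR_ge1Dx v; rewrite vn expRN /harmonic /= => ev hx.
  have n0 : 0 <= n%:R :> R by [].
  have p0 := @normal_peak_ge0 R 1.
  have e0 := expR_gt0 (n%:R ^+ 2 / 2 : R).
  apply: (@le_trans _ _ (C * (1 + n%:R) * (normal_peak 1 * (expR (n%:R ^+ 2 / 2))^-1))).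
    by apply: ler_wpM2r => //; rewrite mulr_ge0 // invr_ge0 ltW.
  set e := expR _ in ev e0 *.
  rewrite mulrACA -!mulrA; apply: ler_wpM2l => //; apply: ler_wpM2l => //.
  rewrite -[n.+1%:R]natr1 ler_pdivrMr // mulrAC ler_pdivlMr; last by rewrite ltr_wpDl.
  nra.
have hb (s : nat -> R) : (forall n, `|s n| = n%:R) ->
    (h (s n) * normal_pdf 0 1 (s n)) @[n --> \oo] --> 0.
  move=> sn; apply: norm_cvg0; apply: (@squeeze_cvgr _ _ _ _ (cst 0)
    (fun n => C * normal_peak 1 * 8 * harmonic n) _).
  - by apply: nearW => n; rewrite normr_ge0 /=; exact: pb.
  - exact: cvg_cst.
  - rewrite -[X in _ --> X](mulr0 (C * normal_peak 1 * 8)).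
    by apply: cvgM; [exact: cvg_cst|exact: cvg_harmonic].
apply: (@integral_derivative_eq0 (fun x => h x * normal_pdf 0 1 x)).
- move=> x; have dp := is_derive_normal_pdf x; have dhx := dh x.
  apply: (is_derive_eq (is_deriveM dhx dp)).
  rewrite /GRing.scale /=; ring.
- by move=> x; apply: cvgM; [exact: cG|exact: cp].
- have iq := @integrable_quad_normal_pdf R.
  (* The factor 3: for [a = |x|], [(1 + a^2) + a (1 + a) <= 3 (1 + a^2)]. *)
  apply: (le_integrable measurableT _ _ (integrableZl measurableT (3 * C) iq)).
    apply/measurable_EFinP; apply: measurable_funM.
      exact: continuous_measurable_fun.
    exact: measurable_normal_pdf.
  move=> x _; rewrite /= lee_fin.
  rewrite mulrA !normrM; apply: ler_wpM2r; first exact: normr_ge0.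
  apply: (le_trans (ler_normB _ _)); rewrite normrM.
  have xx : `|x| ^+ 2 = x ^+ 2 by rewrite real_normK ?num_real.
  rewrite (ger0_norm C0) (@ger0_norm _ 3) //.
  rewrite (@ger0_norm _ (1 + _)) ?addr_ge0 ?sqr_ge0 //.
  have aux (a b c : R) : 0 <= a -> b <= C * (1 + a) -> c <= C * (1 + a ^+ 2) ->
      c + a * b <= 3 * C * (1 + a ^+ 2).
    move=> a0 bC cC.
    have : a * b <= a * (C * (1 + a)) by apply: ler_wpM2l.
    have : 0 <= C * (a - 1) ^+ 2 by rewrite mulr_ge0 ?sqr_ge0.
    nra.
  by rewrite -xx; apply: aux; rewrite ?xx.
- by apply: hb => n; rewrite ger0_norm.
- by apply: hb => n; rewrite normrN ger0_norm.
Qed.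

End Stein.

(** * Independence *)

Definition mfun_of d d' (T : measurableType d) (T' : measurableType d')
    (g : T -> T') (mg : measurable_fun [set: T] g) : {mfun T >-> T'} :=
  HB.pack g (isMeasurableFun.Build _ _ _ _ g mg).

(** The codomains are arbitrary because one of the maps will be the identity of the sample space,
    read with a smaller sigma-algebra on the target. *)
Definition independent_maps d d1 d2 (T : measurableType d)
    (T1 : measurableType d1) (T2 : measurableType d2) (R : realType)
    (P : probability T R) (U : T -> T1) (V : T -> T2) : Prop :=
  forall A B, measurable A -> measurable B ->
    P (U @^-1` A `&` V @^-1` B) = (P (U @^-1` A) * P (V @^-1` B))%E.

Section IndependentMaps.
Context d d1 d2 (T : measurableType d) (T1 : measurableType d1)
  (T2 : measurableType d2) (R : realType) (P : probability T R).
Variables (U : T -> T1) (V : T -> T2).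
Hypotheses (mU : measurable_fun [set: T] U) (mV : measurable_fun [set: T] V).
Hypothesis UV : independent_maps P U V.

Let PU := distribution P (mfun_of mU).
Let PV := distribution P (mfun_of mV).
Let mpair := measurable_fun_pair mU mV.
Let PUV := distribution P (mfun_of mpair).

Lemma distribution_pair (A : set (T1 * T2)) : measurable A ->
  (PU \x PV)%E A = PUV A.
Proof.
by move=> mA; apply: product_measure_unique => // A1 A2 mA1 mA2; exact: UV.
Qed.

Lemma ge0_integral_independent (G : T1 * T2 -> \bar R) :
  measurable_fun [set: T1 * T2] G -> (forall z, 0 <= G z)%E ->
  (\int[P]_w G (U w, V w) = \int[P]_w \int[PU]_x G (x, V w))%E.
Proof.
move=> mG G0.
transitivity (\int[PUV]_z G z)%E.
  by rewrite ge0_integral_distribution.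
transitivity (\int[(PU \x PV)%E]_z G z)%E.
  by apply: eq_measure_integral => A mA _; exact/esym/distribution_pair.
rewrite fubini_tonelli2 // ge0_integral_distribution //.
  exact: measurable_fun_fubini_tonelli_G.
by move=> y; apply: integral_ge0.
Qed.

(** Fubini requires integrability under the product law; this is obtained from that of [G (U, V)] by
    the Tonelli version applied to the absolute value. *)
Lemma integral_independent (G : T1 * T2 -> \bar R) :
  measurable_fun [set: T1 * T2] G ->
  P.-integrable [set: T] (fun w => G (U w, V w)) ->
  (\int[P]_w G (U w, V w) = \int[PV]_y \int[PU]_x G (x, y))%E.
Proof.
move=> mG iG.
transitivity (\int[PUV]_z G z)%E.
  by rewrite integral_distribution.
transitivity (\int[(PU \x PV)%E]_z G z)%E.
  by apply: eq_measure_integral => A mA _; exact/esym/distribution_pair.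
rewrite fubini2 //; apply/integrable21ltyP => //.
have := iG => /integrableP[_]; apply: le_lt_trans.
have mabsG : measurable_fun [set: T1 * T2] (abse \o G) by exact: measurableT_comp.
rewrite (ge0_integral_independent mabsG) => [|z]; last exact: abse_ge0.
rewrite -(@ge0_integral_distribution _ _ _ _ _ _ (mfun_of mV)
  (fun y => \int[PU]_x `|G (x, y)|)%E) //.
  apply: (@measurable_fun_fubini_tonelli_G _ _ _ _ _ PU (abse \o G)) => // z.
  exact: abse_ge0.
by move=> y; apply: integral_ge0.
Qed.

End IndependentMaps.

Section IndependentReals.
Context d (T : measurableType d) (R : realType) (P : probability T R).

Lemma independent_integralM (Z W : T -> R) :
  measurable_fun [set: T] Z -> measurable_fun [set: T] W ->
  independent_maps P Z W ->
  P.-integrable [set: T] (EFin \o Z) -> P.-integrable [set: T] (EFin \o W) ->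
  P.-integrable [set: T] (fun w => (Z w * W w)%:E) /\
  (\int[P]_w (Z w * W w)%:E = \int[P]_w (Z w)%:E * \int[P]_w (W w)%:E)%E.
Proof.
move=> mZ mW ZW iZ iW.
have mM : measurable_fun [set: R * R] (fun z => (z.1 * z.2)%:E).
  by apply/measurable_EFinP; apply: measurable_funM.
have iZW : P.-integrable [set: T] (fun w => (Z w * W w)%:E).
  apply/integrableP; split.
    by apply/measurable_EFinP; exact: measurable_funM.
  have mnorm : measurable_fun [set: R] (fun x : R => `|x|%:E).
    by apply/measurable_EFinP; exact: normr_measurable.
  have mabs : measurable_fun [set: R * R] (fun z => `|(z.1 * z.2)%:E|)%E.
    exact: measurableT_comp.
  rewrite (ge0_integral_independent mZ mW ZW mabs) => [|z]; last exact: abse_ge0.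
  have E w : (\int[distribution P (mfun_of mZ)]_x `|((x, W w).1 * (x, W w).2)%:E| =
      (\int[P]_w `|(Z w)%:E|) * `|(W w)%:E|)%E.
    under eq_integral do rewrite /= normrM mulrC EFinM.
    rewrite ge0_integralZl // muleC; congr (_ * _)%E.
    exact: (@ge0_integral_distribution _ _ _ _ _ P (mfun_of mZ) (fun x => `|x|%:E)).
  under eq_integral do rewrite E.
  have /integrableP[_ fZ] := iZ; have /integrableP[_ fW] := iW.
  rewrite ge0_integralZl //.
  - by apply: lte_mul_pinfty => //; [apply: integral_ge0|rewrite ge0_fin_numE // integral_ge0].
  - by apply/measurable_EFinP; exact: measurableT_comp.
  - by apply: integral_ge0.
split => //.
rewrite (@integral_independent _ _ _ _ _ _ _ P _ _ mZ mW ZW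
    (fun z => (z.1 * z.2)%:E)) //=.
have fZ := integrable_fin_num measurableT iZ.
under eq_integral.
  move=> y _; under eq_integral do rewrite mulrC EFinM.
  rewrite integralZl //; last first.
    by apply: integrable_pushforward.
  rewrite (@integral_distribution _ _ _ _ _ P (mfun_of mZ) EFin) //.
  rewrite -(fineK fZ) muleC.
  over.
rewrite integralZl //; last by apply: integrable_pushforward.
rewrite (@integral_distribution _ _ _ _ _ P (mfun_of mW) EFin) //.
by rewrite fineK.
Qed.

End IndependentReals.

(** * Independence of one coordinate from all the others *)

Section OtherCoordinates.
Context d (T : measurableType d) (R : realType) (P : probability T R).
Variables (X : nat -> {RV P >-> R}) (a : nat).

Definition other_cylinders : set (set T) :=
  [set S | exists J : {fset nat}, exists A : nat -> set R,
    [/\ a \notin J, forall i, measurable (A i) &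
        S = \bigcap_(i in [set` J]) (X i @^-1` A i)]].

(** The sample space with the sigma-algebra generated by the [X b], [b != a]. Freezing the other
    coordinates then amounts to fixing a sample point, and no product space has to be built. *)
Definition other_coordinates := g_sigma_algebraType other_cylinders.

Definition to_others (w : T) : other_coordinates := w.

Lemma measurable_cylinder S : other_cylinders S -> measurable S.
Proof.
move=> [J [A [_ mA ->]]]; apply: fin_bigcap_measurable => // i _.
by rewrite -[_ @^-1` _]setTI; exact: measurable_funP.
Qed.

Lemma other_cylindersI : setI_closed other_cylinders.
Proof.
move=> _ _ [J [A [aJ mA ->]]] [J' [A' [aJ' mA' ->]]].
exists (J `|` J')%fset.
exists (fun i => (if i \in J then A i else setT) `&`
                 (if i \in J' then A' i else setT)).
split.
- by rewrite in_fsetU negb_or aJ aJ'.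
- by move=> i; apply: measurableI; case: ifP.
- apply/seteqP; split => w /=.
    by move=> [JA JA'] i _; split; case: ifP => // iJ; [apply: JA|apply: JA'].
  move=> H; split => i /= iJ.
    by have /= := H i; rewrite in_fsetU iJ => /(_ isT) [].
  by have /= := H i; rewrite in_fsetU iJ orbT => /(_ isT) [].
Qed.

Lemma measurable_to_others : measurable_fun [set: T] to_others.
Proof.
move=> _ A mA; rewrite setTI.
have := mA; apply: smallest_sub.
  exact: sigma_algebra_measurable.
exact: measurable_cylinder.
Qed.

Lemma measurable_other (b : nat) : b != a ->
  measurable_fun [set: other_coordinates] (X b : other_coordinates -> R).
Proof.
move=> ba _ A mA; rewrite setTI; apply: sub_sigma_algebra.
exists [fset b]%fset, (fun=> A); split => //.
  by rewrite in_fset1 eq_sym.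
apply/seteqP; split => w /=.
  by move=> XA i /=; rewrite in_fset1 => /eqP ->.
by apply => /=; rewrite in_fset1.
Qed.

(** For fixed [B], the measures of [A] given by [P (A and X a in B)] and by [P (X a in B) * P A]
    agree on the cylinders, which are stable under intersection, hence on the sigma-algebra they
    generate. *)
Lemma independent_others : mutually_independent X ->
  independent_maps P (X a) to_others.
Proof.
move=> Xind B A mB mA.
have mXB : measurable (X a @^-1` B).
  by rewrite -[_ @^-1` _]setTI; exact: measurable_funP.
have pge0 : 0 <= fine (P (X a @^-1` B)) by rewrite fine_ge0.
pose m1 : {measure set T -> \bar R} := mrestr P mXB.
pose m2 : {measure set T -> \bar R} := mscale (NngNum pge0) P.
suff : m1 A = m2 A.
  rewrite /m1 /m2 /= /mrestr /mscale /= fineK ?fin_num_measure // => E.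
  by rewrite setIC E.
apply: (@g_sigma_algebra_measure_unique _ _ _ other_cylinders measurable_cylinder
  (fun=> setT) _ _ m1 m2) => //.
- move=> _; exists fset0, (fun=> setT); split => //.
  by apply/seteqP; split => w.
- by apply/seteqP; split => w // _; exists 0%N.
- exact: other_cylindersI.
- move=> S [J [C [aJ mC ->]]].
  rewrite /m1 /m2 /= /mrestr /mscale /= fineK ?fin_num_measure //.
  (* One family of sets for the enlarged index set: [a] is not in [J], so changing the value at [a]
     leaves the cylinder untouched. *)
  pose D i := if i == a then B else C i.
  have mD i : measurable (D i) by rewrite /D; case: ifP.
  have DC i : i \in J -> D i = C i.
    by rewrite /D; case: eqP => // ->; rewrite (negbTE aJ).
  have := Xind (a |` J)%fset D mD; rewrite big_fsetU1 //= /D eqxx -/(D _).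
  have -> : (\prod_(j <- J) P (X j @^-1` (if j == a then B else C j)) =
      \prod_(j <- J) P (X j @^-1` C j))%E.
    rewrite big_seq [RHS]big_seq; apply: eq_bigr => i iJ.
    by rewrite -/(D i) DC.
  rewrite -Xind // => <-; congr (P _).
  apply/seteqP; split => w /=.
    move=> [JC XB] i /=; rewrite in_fset1U => /orP[/eqP ->|iJ]; first by rewrite eqxx.
    by rewrite -/(D i) DC //; apply: JC.
  move=> H; split.
    move=> i /= iJ; have /= := H i; rewrite in_fset1U iJ orbT => /(_ isT).
    by rewrite -/(D i) DC.
  by have /= := H a; rewrite in_fset1U eqxx => /(_ isT).
- move=> _; rewrite /m1 /= /mrestr setTI.
  by rewrite -ge0_fin_numE // fin_num_measure.
Qed.

(* Lebesgue and normal measures live on [measurableTypeR R], which has the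
   sigma-algebra of [R] but a display that is not convertible to that of [R]. *)
Lemma expectation_stein (G : measurableTypeR R * other_coordinates -> R) :
  standard_gaussian (X a) -> mutually_independent X ->
  measurable_fun [set: measurableTypeR R * other_coordinates] G ->
  P.-integrable [set: T] (fun w => (G (X a w, w))%:E) ->
  (forall v, \int[normal_prob 0 1]_x (G (x, v))%:E = 0)%E ->
  (\int[P]_w (G (X a w, w))%:E = 0)%E.
Proof.
move=> Xg Xind mG iG G0.
have mXa : measurable_fun [set: T] (X a : T -> measurableTypeR R).
  by move=> mT A mA; exact: measurable_funP.
have mEG : measurable_fun [set: measurableTypeR R * other_coordinates] (EFin \o G).
  exact/measurable_EFinP.
have ind : independent_maps P (X a : T -> measurableTypeR R) to_others.
  by move=> A B mA mB; exact: independent_others.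
have := integral_independent mXa measurable_to_others ind mEG iG.
rewrite /= => ->; apply: integral0_eq => v _.
rewrite -[RHS](G0 v); apply: eq_measure_integral => A mA _.
exact: (Xg A mA).
Qed.

End OtherCoordinates.

Section SequenceCoordinates.
Context d (T : measurableType d) (R : realType) (P : probability T R).
Variable X : nat -> {RV P >-> R}.

Definition sequence_space := g_sigma_algebraType
  (\bigcup_k preimage_set_system [set: T] (X k) measurable).

Lemma measurable_coordinate (k : nat) :
  measurable_fun [set: sequence_space] (X k : sequence_space -> R).
Proof.
by move=> _ A mA; apply: sub_sigma_algebra; exists k => //; exists A.
Qed.

End SequenceCoordinates.

Lemma independent_sequences_maps d (T : measurableType d) (R : realType)
    (P : probability T R) (X Y : nat -> {RV P >-> R}) (Z W : T -> R) :
  independent_sequences X Y ->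
  measurable_fun [set: sequence_space X] Z ->
  measurable_fun [set: sequence_space Y] W -> independent_maps P Z W.
Proof.
move=> XY mZ mW A B mA mB; apply: XY.
- by have := mZ measurableT A mA; rewrite setTI.
- by have := mW measurableT B mB; rewrite setTI.
Qed.

Section SteinQuadratic.
Context {R : realType}.
Implicit Types (k b c s x : R).

(** One coordinate at a time, the damped form is the exponential of a quadratic polynomial and every
    increment is affine, here [al * x + be]. This is the Stein identity for their product. *)
Lemma stein_quadratic (al be k b c s : R) : 0 <= s ->
  (forall x, 0 <= k * x ^+ 2 + 2 * b * x + c) ->
  (\int[normal_prob 0 1]_x
     ((al - (al * x + be) * (s * (k * x + b)) - x * (al * x + be)) *
      expR (- (s / 2 * (k * x ^+ 2 + 2 * b * x + c))))%:E = 0)%E.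
Proof.
move=> s0 q0.
pose e x := expR (- (s / 2 * (k * x ^+ 2 + 2 * b * x + c))).
pose h x := (al * x + be) * e x.
pose h' x := (al - (al * x + be) * (s * (k * x + b))) * e x.
have e1 x : `|e x| <= 1.
  rewrite ger0_norm ?expR_ge0 // -[leRHS]expR0 ler_expR oppr_le0.
  by rewrite mulr_ge0 // divr_ge0.
have de (x : R) : is_derive x 1 e (- (s * (k * x + b)) * e x).
  pose q x := - (s / 2 * (k * x ^+ 2 + 2 * b * x + c)).
  have dq : is_derive x 1 q (- (s * (k * x + b))).
    by apply: is_derive_eq; rewrite /GRing.scale /=; field.
  rewrite mulrC; exact: (@is_derive1_comp _ expR q _ _ _ (is_derive_expR (q x)) dq).
have dh (x : R) : is_derive x 1 h (h' x).
  have dl : is_derive x 1 (fun x => al * x + be) al.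
    by apply: is_derive_eq; rewrite /GRing.scale /=; ring.
  apply: (is_derive_eq (is_deriveM dl (de x))).
  by rewrite /GRing.scale /= /h'; ring.
have ce : continuous e.
  by move=> x; apply/differentiable_continuous/derivable1_diffP; case: (de x).
have ch' : continuous h'.
  move=> x; apply: cvgM; last exact: ce.
  apply: cvgB; first exact: cvg_cst.
  have clin (p q : R) : continuous (fun y => p * y + q).
    move=> y; apply/differentiable_continuous/derivable1_diffP.
    exact: ex_derive.
  apply: cvgM; first exact: clin.
  by apply: cvgM; [exact: cvg_cst|exact: clin].
set A := `|al| + `|be|; set B := s * (`|k| + `|b|).
have A0 : 0 <= A by rewrite addr_ge0.
have B0 : 0 <= B by rewrite mulr_ge0 // addr_ge0.
have lin (p q x : R) : `|p * x + q| <= (`|p| + `|q|) * (1 + `|x|).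
  rewrite (le_trans (ler_normD _ _)) // normrM.
  have := normr_ge0 p; have := normr_ge0 q; have := normr_ge0 x; nra.
(* Since [|e x| <= 1], the function [h] is at most [A (1 + |x|)], and [h'] at most
   [|al| + A B (1 + |x|)^2], where [(1 + |x|)^2 <= 2 (1 + x^2)]. *)
rewrite -[RHS](@integral_normal_stein R h h' (A + `|al| + 2 * (A * B)) dh ch').
- by apply: eq_integral => x _; rewrite /h' /h /e; congr (_%:E); ring.
- move=> x; rewrite normrM -[leRHS]mulr1; apply: ler_pM => //.
  apply: (le_trans (lin _ _ _)); apply: ler_wpM2r; first by rewrite addr_ge0.
  by rewrite -addrA lerDl addr_ge0 // !mulr_ge0.
- move=> x; rewrite normrM -[leRHS]mulr1; apply: ler_pM => //.
  rewrite (le_trans (ler_normB _ _)) //.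
  rewrite -[x ^+ 2]real_normK ?num_real // !normrM (ger0_norm s0).
  have := lin al be x; have := lin k b x; rewrite -/A.
  have := normr_ge0 (al * x + be); have := normr_ge0 (k * x + b).
  have := normr_ge0 x; have := normr_ge0 al.
  move: `|x| `|al * x + be| `|k * x + b| => t u v al0 t0 v0 u0 vk uA.
  have sv : s * v <= B * (1 + t) by rewrite /B -mulrA ler_wpM2l.
  have : u * (s * v) <= A * (1 + t) * (B * (1 + t)) by apply: ler_pM => //; exact: mulr_ge0.
  have AB0 : 0 <= A * B by exact: mulr_ge0.
  have : 0 <= A * B * (1 - t) ^+ 2 by rewrite mulr_ge0 ?sqr_ge0.
  have : 0 <= A * (1 + t ^+ 2) by rewrite mulr_ge0 // addr_ge0 ?sqr_ge0.
  have : 0 <= `|al| * t ^+ 2 by rewrite mulr_ge0 ?sqr_ge0.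
  nra.
Qed.

End SteinQuadratic.

Section GaussianSquare.
Context d (T : measurableType d) (R : realType) (P : probability T R).

Lemma standard_gaussian_sqr_integrable (Z : {RV P >-> R}) :
  standard_gaussian Z -> P.-integrable [set: T] (fun w => (Z w ^+ 2)%:E).
Proof.
move=> Zg.
have mZ : measurable_fun [set: T] (Z : T -> measurableTypeR R).
  by move=> mT A mA; exact: measurable_funP.
have mZ2 : measurable_fun [set: R] (fun x : R => (x ^+ 2)%:E).
  by apply/measurable_EFinP; exact: measurable_funX.
have sq0 (x : R) : (0 <= (x ^+ 2)%:E)%E by rewrite lee_fin sqr_ge0.
apply/integrableP; split.
  by apply/measurable_EFinP; apply: measurable_funX; exact: measurable_funP.
under eq_integral do rewrite gee0_abs //.
rewrite -(@ge0_integral_distribution _ _ _ _ _ P (mfun_of mZ) (fun x => (x ^+ 2)%:E)) //.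
rewrite (eq_measure_integral (normal_prob 0 1)) => [|A mA _]; last exact: (Zg A mA).
rewrite ge0_integral_normal //.
have := @integrable_quad_normal_pdf R => /integrableP[mq]; apply: le_lt_trans.
apply: ge0_le_integral => //.
- by move=> x _; rewrite -EFinM lee_fin mulr_ge0 ?sqr_ge0 ?normal_pdf_ge0.
- apply: emeasurable_funM => //.
  by apply/measurable_EFinP; exact: measurable_normal_pdf.
- exact: measurableT_comp.
- move=> x _; rewrite -EFinM lee_fin.
  apply: (le_trans _ (ler_norm _)); apply: ler_wpM2r; first exact: normal_pdf_ge0.
  by rewrite lerDr.
Qed.

End GaussianSquare.

(** * Moments of a damped Gaussian quadratic form *)

Section BilinearForm.
Context {R : realType} {m : nat}.
Implicit Types (K : 'M[R]_m) (x y : 'I_m -> R).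

Definition bform K x y : R := \sum_j \sum_k K j k * (x j * y k).

Definition upd x (a : 'I_m) (t : R) (j : 'I_m) : R := if j == a then t else x j.

Lemma upd_id x a : upd x a (x a) = x.
Proof. by apply/funext => j; rewrite /upd; case: eqP => // ->. Qed.

Lemma upd_lin x a t c :
  upd x a t c = (a == c)%:R * t + (if c == a then 0 else x c).
Proof.
by rewrite /upd eq_sym; case: eqP => _; rewrite ?mul1r ?addr0 ?mul0r ?add0r.
Qed.

Lemma sum_upd K x a t :
  \sum_k K a k * upd x a t k = K a a * t + \sum_(k | k != a) K a k * x k.
Proof.
rewrite (bigD1 a) //= /upd eqxx; congr (_ + _).
by apply: eq_bigr => k /negbTE ->.
Qed.

(** Brings the form to the shape of [stein_quadratic]: the coefficients on the right do not involve
    [x a]. *)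
Lemma bform_upd K x a t : (forall j k, K j k = K k j) ->
  bform K (upd x a t) (upd x a t) = K a a * t ^+ 2 +
    2 * (\sum_(k | k != a) K a k * x k) * t +
    \sum_(j | j != a) \sum_(k | k != a) K j k * (x j * x k).
Proof.
move=> sK; rewrite /bform (bigD1 a) //=.
have -> : \sum_k K a k * (upd x a t a * upd x a t k) =
    t * (\sum_k K a k * upd x a t k).
  by rewrite mulr_sumr; apply: eq_bigr => k _; rewrite {1}/upd eqxx; ring.
have -> : \sum_(i | i != a) \sum_k K i k * (upd x a t i * upd x a t k) =
    t * (\sum_(k | k != a) K a k * x k) +
    \sum_(j | j != a) \sum_(k | k != a) K j k * (x j * x k).
  rewrite mulr_sumr -big_split /=; apply: eq_bigr => j ja.
  rewrite (bigD1 a) //= /upd eqxx (negbTE ja) sK; congr (_ + _); first by ring.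
  by apply: eq_bigr => k /negbTE ->.
rewrite sum_upd; ring.
Qed.

End BilinearForm.

Section GaussianForm.
Context d (T : measurableType d) (R : realType) (P : probability T R).
Variables (X : nat -> {RV P >-> R}) (m : nat) (K : 'M[R]_m).
Hypotheses (X_gauss : forall k, standard_gaussian (X k))
  (X_indep : mutually_independent X).
Hypotheses (K_sym : forall j k, K j k = K k j)
  (K_psd : forall x, 0 <= bform K x x).
Implicit Types (s : R) (w : T).

(* The 0-th increment does not enter the empirical covariances. *)
Definition increments w (j : 'I_m) : R := X j.+1 w.

Definition damping s w : R :=
  expR (- (s / 2 * bform K (increments w) (increments w))).

Lemma measurable_increment j : measurable_fun [set: T] (increments ^~ j).
Proof. exact: measurable_funP. Qed.

Lemma measurable_bform d' (T' : measurableType d') (u v : T' -> 'I_m -> R) :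
  (forall j, measurable_fun [set: T'] (u ^~ j)) ->
  (forall j, measurable_fun [set: T'] (v ^~ j)) ->
  measurable_fun [set: T'] (fun z => bform K (u z) (v z)).
Proof.
move=> mu mv; apply: measurable_sum => j; apply: measurable_sum => k.
by apply: measurable_funM => //; apply: measurable_funM.
Qed.

Lemma measurable_damping s : measurable_fun [set: T] (damping s).
Proof.
apply: measurableT_comp => //; apply: measurableT_comp => //.
apply: measurable_funM => //.
by apply: measurable_bform => j; exact: measurable_increment.
Qed.

Lemma damping_ge0 s w : 0 <= damping s w.
Proof. exact: expR_ge0. Qed.

Lemma damping_le1 s w : 0 <= s -> damping s w <= 1.
Proof.
move=> s0; rewrite -[leRHS]expR0 ler_expR oppr_le0.
by rewrite mulr_ge0 // divr_ge0.
Qed.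

Lemma integrable_increments2 j k :
  P.-integrable [set: T] (fun w => (increments w j ^+ 2 + increments w k ^+ 2)%:E).
Proof.
under eq_fun do rewrite EFinD.
by apply: integrableD => //; exact: standard_gaussian_sqr_integrable.
Qed.

Lemma integrable_moment s j k : 0 <= s ->
  P.-integrable [set: T]
    (fun w => (increments w j * increments w k * damping s w)%:E).
Proof.
move=> s0; apply: (le_integrable measurableT _ _ (integrable_increments2 j k)).
  apply/measurable_EFinP; apply: measurable_funM; last exact: measurable_damping.
  by apply: measurable_funM; exact: measurable_increment.
move=> w _; rewrite /= lee_fin [leRHS]ger0_norm ?addr_ge0 ?sqr_ge0 //.
rewrite normrM (ger0_norm (damping_ge0 _ _)).
apply: (@le_trans _ _ `|increments w j * increments w k|).
  by rewrite ler_piMr // damping_le1.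
have := sqr_ge0 (`|increments w j| - `|increments w k|).
rewrite normrM sqrrB !real_normK ?num_real //.
have := sqr_ge0 (increments w j); have := sqr_ge0 (increments w k); lra.
Qed.

Lemma integrable_damping s : 0 <= s ->
  P.-integrable [set: T] (EFin \o damping s).
Proof.
move=> s0.
have i1 : P.-integrable [set: T] (EFin \o cst 1%R).
  exact: finite_measure_integrable_cst.
apply: (le_integrable measurableT _ _ i1).
  by apply/measurable_EFinP; exact: measurable_damping.
move=> w _; rewrite /= lee_fin normr1 ger0_norm ?damping_ge0 //.
exact: damping_le1.
Qed.

Lemma stein_integrandE s (a c : 'I_m) w :
  (((a == c)%:R - increments w c * (s * \sum_k K a k * increments w k)
     - increments w a * increments w c) * damping s w)%:E =
  ((a == c)%:R%:E * (damping s w)%:E -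
   (s%:E * \sum_k ((K a k)%:E * (increments w k * increments w c * damping s w)%:E)
    + (increments w a * increments w c * damping s w)%:E))%E.
Proof.
have -> : (\sum_k ((K a k)%:E * (increments w k * increments w c * damping s w)%:E) =
    (\sum_k K a k * (increments w k * increments w c * damping s w))%:E)%E.
  by rewrite -sumEFin; apply: eq_bigr => k _; rewrite EFinM.
rewrite -!EFinM -!EFinD; congr (_%:E).
rewrite !mulrBl -addrA -opprD; congr (_ - (_ + _)).
rewrite mulrCA -mulrA; congr (_ * _).
rewrite mulr_sumr mulr_suml; apply: eq_bigr => k _; ring.
Qed.

(** Integration by parts in the coordinate [a] for the test function [x_c] times the damping, whose
    derivative is [(a == c) - x_c * s * (K x)_a] times the damping. *)
Lemma damping_stein s (a c : 'I_m) : 0 <= s ->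
  (\int[P]_w (((a == c)%:R
     - increments w c * (s * \sum_k K a k * increments w k)
     - increments w a * increments w c) * damping s w)%:E = 0)%E.
Proof.
move=> s0.
(* Coordinate [a] comes from the first component and the others from the second, so [(X a.+1 w, w)]
   gives back the increments at [w]. *)
pose y (z : measurableTypeR R * other_coordinates X a.+1) : 'I_m -> R :=
  upd (increments z.2) a z.1.
pose G z := ((a == c)%:R - y z c * (s * \sum_k K a k * y z k) - z.1 * y z c)
  * expR (- (s / 2 * bform K (y z) (y z))).
have m1 : measurable_fun [set: measurableTypeR R * other_coordinates X a.+1]
    (fun z => z.1 : R).
  by move=> mT A mA; exact: (@measurable_fst _ _ (measurableTypeR R)).
have my j : measurable_fun [set: measurableTypeR R * other_coordinates X a.+1]
    (y ^~ j).
  rewrite /y /upd; case: eqP => [_|/eqP ja]; first exact: m1.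
  have mo : measurable_fun [set: other_coordinates X a.+1] (increments ^~ j).
    by apply: measurable_other.
  exact: measurableT_comp mo (measurable_snd).
have mG : measurable_fun [set: measurableTypeR R * other_coordinates X a.+1] G.
  apply: measurable_funM.
    apply: measurable_funB; last exact: measurable_funM.
    apply: measurable_funB => //; apply: measurable_funM => //.
    apply: measurable_funM => //; apply: measurable_sum => k.
    exact: measurable_funM.
  apply: measurableT_comp => //; apply: measurableT_comp => //.
  by apply: measurable_funM => //; exact: measurable_bform.
have yX w : y (X a.+1 w, w) = increments w by exact: upd_id.
have GX w : G (X a.+1 w, w) = ((a == c)%:R
     - increments w c * (s * \sum_k K a k * increments w k)
     - increments w a * increments w c) * damping s w.
  by rewrite /G yX.
rewrite -[RHS](@expectation_stein _ _ _ _ _ a.+1 G (X_gauss _) X_indep mG).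
- by apply: eq_integral => w _; rewrite GX.
- under eq_fun do rewrite GX.
  under eq_fun do rewrite stein_integrandE.
  apply: integrableB => //.
    by apply: integrableZl => //; exact: integrable_damping.
  apply: integrableD => //; last exact: integrable_moment.
  apply: integrableZl => //; apply: integrable_sum => // k _.
  by apply: integrableZl => //; exact: integrable_moment.
- move=> v.
  set b := \sum_(k | k != a) K a k * increments v k.
  set q := \sum_(j | j != a) \sum_(k | k != a) K j k * (increments v j * increments v k).
  have qE t : bform K (y (t, v)) (y (t, v)) = K a a * t ^+ 2 + 2 * b * t + q.
    by rewrite /y /= bform_upd.
  have := @stein_quadratic R (a == c)%:R (if c == a then 0 else increments v c)
    (K a a) b q s s0.
  move=> <- => [|t]; last by rewrite -qE.
  apply: eq_integral => t _; rewrite /G qE; congr (_%:E).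
  by rewrite /y /= sum_upd upd_lin.
Qed.

Definition mgf s : R := \int[P]_w damping s w.

Definition moment_mx s : 'M[R]_m :=
  \matrix_(j, k) \int[P]_w (increments w j * increments w k * damping s w).

Lemma moment_mx_sym s j k : moment_mx s j k = moment_mx s k j.
Proof.
by rewrite !mxE; apply: eq_Rintegral => w _; rewrite (mulrC (increments w j)).
Qed.

Lemma integral_moment s j k : 0 <= s ->
  (\int[P]_w (increments w j * increments w k * damping s w)%:E =
   (moment_mx s j k)%:E)%E.
Proof.
move=> s0; rewrite mxE /Rintegral fineK // integrable_fin_num //.
exact: integrable_moment.
Qed.

(** Entry [(a, c)] is [damping_stein] after expanding the integral by linearity. *)
Lemma moment_mxE s : 0 <= s -> (1%:M + s *: K) *m moment_mx s = (mgf s)%:M.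
Proof.
move=> s0; apply/matrixP => a c.
rewrite mulmxDl mul1mx -scalemxAl !mxE.
have := damping_stein a c s0.
have iM j k := integrable_moment j k s0; have iD := integrable_damping s0.
have -> : (\int[P]_w (((a == c)%:R
     - increments w c * (s * \sum_k K a k * increments w k)
     - increments w a * increments w c) * damping s w)%:E =
  ((a == c)%:R * mgf s - (s * (\sum_k K a k * moment_mx s k c) + moment_mx s a c))%:E)%E.
  transitivity (\int[P]_w ((a == c)%:R%:E * (damping s w)%:E
     - (s%:E * \sum_k ((K a k)%:E * (increments w k * increments w c * damping s w)%:E)
       + (increments w a * increments w c * damping s w)%:E)))%E.
    by apply: eq_integral => w _; rewrite stein_integrandE.
  have iS : P.-integrable [set: T] (fun w =>
      \sum_k ((K a k)%:E * (increments w k * increments w c * damping s w)%:E))%E.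
    by apply: integrable_sum => // k _; exact: integrableZl.
  have fM j k : (\int[P]_w (increments w j * increments w k * damping s w)%:E =
      (moment_mx s j k)%:E)%E.
    exact: integral_moment.
  rewrite integralB //; last 2 first.
  - exact: integrableZl.
  - by apply: integrableD => //; exact: integrableZl.
  rewrite integralD //; last exact: integrableZl.
  rewrite !integralZl // integral_sum //; last by move=> k; exact: integrableZl.
  under eq_bigr do rewrite integralZl // fM -EFinM.
  rewrite sumEFin fM /mgf /Rintegral -!EFinM -EFinD EFinB EFinM fineK //.
  by rewrite integrable_fin_num.
move=> [] /eqP; rewrite subr_eq0 => /eqP E.
by rewrite addrC -mulr_natl E mxE.
Qed.

End GaussianForm.

(** * Derivative and continuity of the Laplace transform *)

Section GaussianFormDerivative.
Context d (T : measurableType d) (R : realType) (P : probability T R).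
Variables (X : nat -> {RV P >-> R}) (m : nat) (K : 'M[R]_m).
Hypotheses (X_gauss : forall k, standard_gaussian (X k))
  (X_indep : mutually_independent X).
Hypotheses (K_sym : forall j k, K j k = K k j)
  (K_psd : forall x, 0 <= bform K x x).
Implicit Types (s : R) (w : T).

Local Notation Q w := (bform K (increments X w) (increments X w)).
Local Notation damping := (damping X K).
Local Notation mgf := (mgf X K).

Lemma mgf0 : mgf 0 = 1.
Proof.
rewrite /mgf /Rintegral (eq_integral (cst 1%:E)) => [|w _].
  rewrite integral_cst // mul1e -[RHS]/(fine (EFin 1)); congr fine.
  exact: probability_setT.
by rewrite /damping !mul0r oppr0 expR0.
Qed.

Lemma mgf_ge0 s : 0 <= mgf s.
Proof. by apply: Rintegral_ge0 => w _; exact: damping_ge0. Qed.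

Lemma integrable_bform : P.-integrable [set: T] (fun w => (Q w)%:E).
Proof.
(* As [damping 0] is 1, the form is a combination of moments already known to be integrable. *)
have -> : (fun w => (Q w)%:E) = (fun w => \sum_j \sum_k (K j k)%:E *
    (increments X w j * increments X w k * damping 0 w)%:E)%E.
  apply/funext => w; rewrite -sumEFin; apply: eq_bigr => j _.
  rewrite -sumEFin; apply: eq_bigr => k _.
  by rewrite -EFinM /damping !mul0r oppr0 expR0 mulr1.
apply: integrable_sum => // j _; apply: integrable_sum => // k _.
by apply: integrableZl => //; exact: integrable_moment.
Qed.

Lemma is_derive_damping w s :
  is_derive s 1 (fun s => damping s w) (- (2^-1) * Q w * damping s w).
Proof.
pose q (s : R) := - (s / 2 * Q w).
have dq : is_derive s 1 q (- (2^-1) * Q w).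
  apply: is_derive_eq; rewrite /GRing.scale /=; ring.
rewrite mulrC; exact: (@is_derive1_comp _ expR q _ _ _ (is_derive_expR (q s)) dq).
Qed.

Lemma Rintegral_bform_damping s : 0 <= s ->
  \int[P]_w (Q w * damping s w) = \tr (K *m moment_mx X K s).
Proof.
move=> s0; have iM j k := integrable_moment X_gauss K_psd j k s0.
rewrite /Rintegral.
transitivity (fine (\int[P]_w \sum_j \sum_k ((K j k)%:E *
    (increments X w j * increments X w k * damping s w)%:E)))%E.
  congr fine; apply: eq_integral => w _.
  rewrite /bform mulr_suml -sumEFin; apply: eq_bigr => j _.
  rewrite mulr_suml -sumEFin; apply: eq_bigr => k _.
  by rewrite -EFinM -!mulrA.
have iKM j k : P.-integrable [set: T] (fun w => (K j k)%:E *
    (increments X w j * increments X w k * damping s w)%:E)%E.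
  exact: integrableZl.
rewrite integral_sum //; last by move=> j; apply: integrable_sum.
rewrite /mxtrace -[RHS]/(fine (EFin _)) -sumEFin; congr fine; apply: eq_bigr => j _.
rewrite integral_sum // mxE -sumEFin; apply: eq_bigr => k _.
rewrite integralZl // mxE EFinM; congr (_ * _)%E.
rewrite /Rintegral fineK ?integrable_fin_num //.
by apply: eq_integral => w _; rewrite [X in X * _]mulrC.
Qed.

Lemma is_derive_mgf s : 0 < s ->
  is_derive s 1 mgf (- (2^-1) * \tr (K *m moment_mx X K s)).
Proof.
move=> s0.
(* A neighbourhood of [s] within the positive parameters: there the damping is at most 1, and half
   the quadratic form dominates the derivative. *)
pose I : set R := `]0, (s + 1)[%classic.
have Is : I s by rewrite /I /= in_itv /= s0 ltrDl ltr01.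
have iD x : I x -> P.-integrable [set: T] (EFin \o damping x).
  by rewrite /I /= in_itv /= => /andP[/ltW x0 _]; exact: integrable_damping.
have dD (x : R) w : I x -> [set: T] w -> derivable (fun s => damping s w) x 1.
  by move=> _ _; case: (is_derive_damping w x).
have d1 (x : R) w : partial1of2 damping x w = - (2^-1) * Q w * damping x w.
  by rewrite partial1of2E; case: (is_derive_damping w x).
pose G w := 2^-1 * Q w.
have G0 w : 0 <= G w by rewrite mulr_ge0 // invr_ge0.
have iG : P.-integrable [set: T] (EFin \o G).
  have := integrableZl measurableT (2^-1) integrable_bform.
  by apply: eq_integrable.
have Gub (x : R) w : I x -> [set: T] w -> `|partial1of2 damping x w| <= G w.
  rewrite /I /= in_itv /= => /andP[/ltW x0 _] _.
  rewrite d1 normrM (ger0_norm (damping_ge0 _ _ _ _)) mulNr normrN.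
  rewrite (ger0_norm (G0 w)) ler_piMr //; exact: damping_le1.
have dm := derivable_under_integral measurableT Is iD dD G0 iG Gub.
apply: (is_derive_eq (derivableP dm)).
rewrite -derive1E (differentiation_under_integral measurableT Is iD dD G0 iG Gub).
rewrite -Rintegral_bform_damping ?ltW // -RintegralZl //.
  by apply: eq_Rintegral => w _; rewrite d1 mulrA.
apply: (le_integrable measurableT _ _ integrable_bform).
  apply/measurable_EFinP; apply: measurable_funM; last exact: measurable_damping.
  by apply: measurable_bform => j; exact: measurable_increment.
move=> w _; rewrite /= lee_fin normrM (ger0_norm (damping_ge0 _ _ _ _)).
by rewrite ler_piMr // damping_le1 // ltW.
Qed.

Lemma continuous_mgf_norm : continuous (fun s => mgf `|s|).
Proof.
move=> s.
suff : {in `]- (`|s| + 1), `|s| + 1[%classic, continuous (fun s => mgf `|s|)}.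
  by apply; rewrite inE /= in_itv /= -ltr_norml ltrDl ltr01.
apply: (@continuity_under_integral R _ T P (fun s w => damping `|s| w)
  [set: T] measurableT (- (`|s| + 1)) (`|s| + 1) _ _ (cst 1)).
- by move=> x _; exact: integrable_damping.
- apply/aeW => w _ x _.
  have cD : continuous (fun s => damping s w).
    move=> y; apply/differentiable_continuous/derivable1_diffP.
    by case: (is_derive_damping w y).
  exact: (cvg_comp _ _ (@norm_continuous _ _ x) (cD `|x|)).
- exact: finite_measure_integrable_cst.
- move=> x _; apply/aeW => w _.
  by rewrite ger0_norm ?damping_ge0 // damping_le1.
Qed.

End GaussianFormDerivative.

(** * Empirical covariances of walks *)

Section EmpiricalCovariance.
Context {R : realType}.
Implicit Types (u v x y : nat -> R).

Let mean (n : nat) u : R := n%:R^-1 * \sum_(1 <= i < n.+1) u i.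

Lemma empirical_cov_centered (n : nat) u v : (0 < n)%N ->
  empirical_cov n u v =
  n%:R^-1 * \sum_(1 <= i < n.+1) (u i - mean n u) * (v i - mean n v).
Proof.
move=> n0; have nn : n%:R != 0 :> R by rewrite pnatr_eq0 -lt0n.
under [in RHS]eq_bigr do rewrite mulrBl !mulrBr.
rewrite !sumrB -!mulr_suml -!mulr_sumr sumr_const_nat subn1 /=.
rewrite /empirical_cov /mean -mulr_natl.
by field.
Qed.

Lemma empirical_cov_ge0 (n : nat) u : (0 < n)%N -> 0 <= empirical_cov n u u.
Proof.
move=> n0; rewrite empirical_cov_centered // mulr_ge0 ?invr_ge0 //.
by apply: sumr_ge0 => i _; rewrite -expr2 sqr_ge0.
Qed.

(** A zero variance makes every centered value of [u] zero. This settles the case where the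
    denominator of the correlation vanishes. *)
Lemma empirical_cov_eq0 (n : nat) u v : (0 < n)%N ->
  empirical_cov n u u = 0 -> empirical_cov n u v = 0.
Proof.
move=> n0; rewrite !empirical_cov_centered // => /eqP.
rewrite mulf_eq0 invr_eq0 pnatr_eq0 (gtn_eqF n0) /= => /eqP E.
rewrite big_nat big1 ?mulr0 // => i ni.
suff /eqP -> : u i - mean n u == 0 by rewrite mul0r.
have : \sum_(1 <= i < n.+1 | (1 <= i < n.+1)%N) (u i - mean n u) * (u i - mean n u) == 0.
  by rewrite -big_nat E.
rewrite psumr_eq0 => [|j _]; last by rewrite -expr2 sqr_ge0.
move=> /allP /(_ i); rewrite mem_index_iota ni => /(_ isT) /=.
by rewrite mulf_eq0 orbb.
Qed.

Lemma partial_sumE (n i : nat) x : (i <= n)%N ->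
  \sum_(j < i) x j = \sum_(j < n) (j < i)%:R * x j.
Proof.
move=> iN; rewrite (big_ord_widen _ _ iN) big_mkcond /=.
by apply: eq_bigr => j _; case: ifP; rewrite ?mul1r ?mul0r.
Qed.

Lemma sum_nat_lt (n j : nat) : (j <= n)%N ->
  \sum_(1 <= i < n.+1) (j < i)%:R = (n - j)%:R :> R.
Proof.
move=> jn; rewrite -natr_sum; congr (_%:R).
elim: n jn => [|n IHn] jn; first by rewrite big_geq // sub0n.
rewrite big_nat_recr //=; move: jn; rewrite leq_eqVlt => /orP[/eqP ->|jn].
  rewrite subnn ltnn addn0 big_nat big1 // => i /andP[_ iN].
  by rewrite ltnNge ltnW.
by rewrite IHn // jn subSn // addn1.
Qed.

(** Counting the indices beyond [j] and [k], the coefficient of [x j * y k] is [(n - max) / n - (n -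
    j) (n - k) / n^2 = min (n - max) / n^2]. It vanishes at index 0 because the first increment
    shifts the whole walk by a constant. *)
Lemma empirical_cov_walk (m : nat) x y :
  empirical_cov m.+1 (fun i => \sum_(j < i) x j) (fun i => \sum_(j < i) y j) =
  bform (bridge_mx m) (fun j => x j.+1) (fun j => y j.+1).
Proof.
set n := m.+1; have nn : n%:R != 0 :> R by rewrite pnatr_eq0.
have E (z : nat -> R) : \sum_(1 <= i < n.+1) \sum_(j < i) z j = \sum_(j < n) (n - j)%:R * z j.
  transitivity (\sum_(1 <= i < n.+1) \sum_(j < n) (j < i)%:R * z j).
    rewrite !big_nat; apply: eq_bigr => i /andP[_ iN].
    exact: partial_sumE.
  rewrite exchange_big /=; apply: eq_bigr => j _.
  by rewrite -mulr_suml sum_nat_lt // ltnW.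
have E2 : \sum_(1 <= i < n.+1) (\sum_(j < i) x j) * (\sum_(j < i) y j) =
    \sum_(j < n) \sum_(k < n) (n - maxn j k)%:R * (x j * y k).
  transitivity (\sum_(1 <= i < n.+1) \sum_(j < n) \sum_(k < n)
      (maxn j k < i)%:R * (x j * y k)).
    rewrite !big_nat; apply: eq_bigr => i /andP[_ iN].
    rewrite (@partial_sumE n i x iN) (@partial_sumE n i y iN) mulr_suml; apply: eq_bigr => j _.
    rewrite mulr_sumr; apply: eq_bigr => k _.
    by rewrite mulrACA -natrM mulnb gtn_max.
  rewrite exchange_big /=; apply: eq_bigr => j _.
  rewrite exchange_big /=; apply: eq_bigr => k _.
  by rewrite -mulr_suml sum_nat_lt // geq_max (ltnW (ltn_ord j)) (ltnW (ltn_ord k)).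
pose c j k : R := (minn j k)%:R * (n - maxn j k)%:R / n%:R ^+ 2.
have -> : empirical_cov n (fun i => \sum_(j < i) x j) (fun i => \sum_(j < i) y j) =
    \sum_(j < n) \sum_(k < n) c j k * (x j * y k).
  rewrite /empirical_cov E2 !E mulr_sumr -mulrA mulr_suml mulr_sumr -sumrB.
  apply: eq_bigr => j _; rewrite 2!mulr_sumr mulr_sumr -sumrB.
  apply: eq_bigr => k _; rewrite /c.
  have jn : (j <= n)%N by exact: ltnW.
  have kn : (k <= n)%N by exact: ltnW.
  case: (leqP j k) => jk; rewrite !natrB //.
    by field.
  by field.
rewrite /n big_ord_recl big1 => [|k _]; last by rewrite /c min0n !mul0r.
rewrite add0r; apply: eq_bigr => j _.
rewrite big_ord_recl /c minn0 !mul0r add0r.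
by apply: eq_bigr => k _; rewrite mxE /green.
Qed.

Lemma bridge_mx_sym (m : nat) (j k : 'I_m) : bridge_mx (F := R) m j k = bridge_mx m k j.
Proof. by rewrite !mxE /green minnC maxnC. Qed.

Lemma bridge_mx_psd (m : nat) (x : 'I_m -> R) : 0 <= bform (bridge_mx m) x x.
Proof.
(* Extends [x], shifted by one, to all indices, so that the form is the empirical variance of a
   walk. The value at index 0 does not affect that variance. *)
pose z (i : nat) : R := if insub i.-1 is Some j then x j else 0.
have -> : x = (fun j : 'I_m => z j.+1).
  by apply/funext => j; rewrite /z /= valK.
by rewrite -empirical_cov_walk empirical_cov_ge0.
Qed.

End EmpiricalCovariance.

(** * The Laplace transform of the empirical variance *)

Section BridgeParameter.
Context {R : realType}.
Implicit Types y : R.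

(* Inverse of [fun s => f (s / n)] on the positive half-line. *)
Definition bridge_param (n : nat) y : R := n%:R * (y + y^-1 - 2).

Lemma bridge_param_ge0 (n : nat) y : 0 < y -> 0 <= bridge_param n y.
Proof.
move=> y0; have -> : bridge_param n y = n%:R * ((y - 1) ^+ 2 / y).
  by rewrite /bridge_param; field; rewrite gt_eqF.
by rewrite mulr_ge0 // divr_ge0 ?sqr_ge0 // ltW.
Qed.

Lemma bridge_param_gt0 (n : nat) y : (0 < n)%N -> 1 < y -> 0 < bridge_param n y.
Proof.
move=> n0 y1; have y0 : 0 < y by exact: lt_trans y1.
have -> : bridge_param n y = n%:R * ((y - 1) ^+ 2 / y).
  by rewrite /bridge_param; field; rewrite gt_eqF.
by rewrite mulr_gt0 ?ltr0n // divr_gt0 // exprn_gt0 // subr_gt0.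
Qed.

Lemma powdiff_gt0 y (k : nat) : (0 < k)%N -> 1 < y -> 0 < powdiff y k.
Proof.
move=> k0 y1; have y0 : 0 < y by exact: lt_trans y1.
rewrite subr_gt0; apply: (@lt_trans _ _ 1); last by rewrite exprn_egt1 ?gtn_eqF.
by rewrite invf_lt1 ?exprn_gt0 // exprn_egt1 ?gtn_eqF.
Qed.

Lemma is_derive_bridge_param (n : nat) y : 0 < y ->
  is_derive y 1 (bridge_param n) (n%:R * powdiff y 1 / y).
Proof.
move=> y0; have yn : y != 0 by rewrite gt_eqF.
have dV := @is_deriveV _ id y 1 1 yn (is_derive_id y 1).
apply: is_derive_eq; rewrite /GRing.scale /= /powdiff expr1.
by field.
Qed.

Lemma is_derive_powdiff (k : nat) y : 0 < y ->
  is_derive y 1 (powdiff ^~ k) (k%:R * powsum y k / y).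
Proof.
move=> y0; have yn : y != 0 by rewrite gt_eqF.
have ykn : y ^+ k != 0 by rewrite expf_neq0.
have dX : is_derive y 1 (fun y : R => y ^+ k) (k%:R * y ^+ k / y).
  have := is_deriveX k (is_derive_id y 1); rewrite exprfctE => dk.
  apply: (is_derive_eq dk).
  rewrite /GRing.scale /= mulr1.
  by case: k {ykn dk} => [|k] /=; rewrite ?mul0r // exprS; field.
have dV := @is_deriveV _ _ y _ 1 ykn dX.
apply: (is_derive_eq (is_deriveB dX dV)).
rewrite /GRing.scale /= /powsum; field.
by rewrite yn ykn.
Qed.

Lemma continuous_mean_power (n : nat) y : 0 < y ->
  {for y, continuous (fun z : R => mean_power z n)}.
Proof.
move=> y0; have yn : y != 0 by rewrite gt_eqF.
have ct (k : nat) : {for y, continuous (fun z : R => z ^+ (n.-1 - k) * z^-1 ^+ k)}.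
  apply: cvgM; first exact: exprn_continuous.
  exact: (continuous_comp (inv_continuous yn) (@exprn_continuous _ k _)).
suff cs (N : nat) :
    {for y, continuous (fun z : R => \sum_(k < N) z ^+ (n.-1 - k) * z^-1 ^+ k)}.
  by apply: cvgM; [exact: cvg_cst|exact: cs].
elim: N => [|N IHN].
  have -> : (fun z : R => \sum_(k < 0) z ^+ (n.-1 - k) * z^-1 ^+ k) = cst 0.
    by apply/funext => z; rewrite big_ord0.
  exact: cvg_cst.
have -> : (fun z : R => \sum_(k < N.+1) z ^+ (n.-1 - k) * z^-1 ^+ k) =
    (fun z : R => \sum_(k < N) z ^+ (n.-1 - k) * z^-1 ^+ k) \+
    (fun z : R => z ^+ (n.-1 - N) * z^-1 ^+ N).
  by apply/funext => z; rewrite big_ord_recr.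
exact: (cvgD IHN (ct N)).
Qed.

End BridgeParameter.

Section BridgeMgf.
Context d (T : measurableType d) (R : realType) (P : probability T R).
Variables (X : nat -> {RV P >-> R}) (m : nat).
Hypotheses (X_gauss : forall k, standard_gaussian (X k))
  (X_indep : mutually_independent X).

Local Notation n := m.+1.
Local Notation K := (bridge_mx m : 'M[R]_m).
Local Notation s := (bridge_param n).
Let K_sym := @bridge_mx_sym R m.
Let K_psd := @bridge_mx_psd R m.

Lemma bridge_moment (y : R) : 1 < y ->
  K *m moment_mx X K (s y) = mgf X K (s y) *: bridge_resolvent m y.
Proof.
move=> y1; have y0 : 0 < y by exact: lt_trans y1.
have sy := bridge_param_ge0 n y0.
apply: (@resolvent_mulmx _ _ _ _ _ (s y)); last exact: moment_mxE.
by apply: bridge_resolventE; rewrite ?pnatr_eq0 ?gt_eqF // powdiff_gt0.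
Qed.

(** Multiplying the trace by [ds/dy = n * powdiff y 1 / y] gives the logarithmic derivative of
    [powdiff y n / powdiff y 1], while [mgf ^+ 2] has logarithmic derivative minus the trace in [s].
    The two cancel. *)
Lemma is_derive_mgf_bridge (y : R) : 1 < y ->
  is_derive y 1 (fun y => mgf X K (s y) ^+ 2 * mean_power y n) 0.
Proof.
move=> y1; have y0 : 0 < y by exact: lt_trans y1.
have yn : y != 0 by rewrite gt_eqF.
have nn : n%:R != 0 :> R by rewrite pnatr_eq0.
have u1 : powdiff y 1 != 0 by rewrite gt_eqF // powdiff_gt0.
have un : powdiff y n != 0 by rewrite gt_eqF // powdiff_gt0.
pose D y : R := n%:R^-1 * powdiff y n * (powdiff y 1)^-1.
apply: (@near_eq_is_derive _ _ _ (fun y => mgf X K (s y) ^+ 2 * D y)).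
  near=> z.
  have z1 : 1 < z by near: z; exact: lt_nbhsr.
  have u1z : powdiff z 1 != 0 by rewrite gt_eqF // powdiff_gt0.
  have z0 : z != 0 by rewrite gt_eqF // (lt_trans _ z1).
  by congr (_ * _); rewrite /D -mean_powerE // mulrC mulKf.
have ds := is_derive_bridge_param n y0.
have := is_derive_mgf X_gauss K_psd (bridge_param_gt0 (ltn0Sn m) y1).
rewrite (bridge_moment y1) mxtraceZ (bridge_resolvent_trace nn yn u1 un) => dm.
have dmc := @is_derive1_comp _ (mgf X K) s y _ _ dm ds.
have dun := is_derive_powdiff n y0.
have du1 := @is_deriveV _ _ y _ 1 u1 (is_derive_powdiff 1 y0).
have dD : is_derive y 1 D _ := is_deriveM (is_deriveZ n%:R^-1 dun) du1.
have dm2 := is_deriveX 2 dmc; rewrite exprfctE /= in dm2.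
apply: (is_derive_eq (is_deriveM dm2 dD)).
rewrite /D /= /GRing.scale /=.
move: (mgf X K (s y)) (powsum y n) (powsum y 1) (powdiff y n) (powdiff y 1)
  un u1 (n%:R) nn => p cn c1 vn v1 vn0 v10 N N0.
by field; rewrite yn vn0 v10 N0.
Unshelve. all: end_near. Qed.

(* The absolute value only serves continuity at the endpoint [y = 1], where
   [s y = 0] and the Laplace transform is known. *)
Lemma mgf_bridge (y : R) : 1 < y -> mgf X K (s y) ^+ 2 * mean_power y n = 1.
Proof.
move=> y1; pose h (y : R) := mgf X K `|s y| ^+ 2 * mean_power y n.
have hE z : 0 < z -> h z = mgf X K (s z) ^+ 2 * mean_power z n.
  by move=> z0; rewrite /h ger0_norm // bridge_param_ge0.
have y0 : 0 < y by exact: lt_trans y1.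
have h1 : h 1 = 1.
  rewrite hE // mean_power1 ?pnatr_eq0 // /bridge_param invr1.
  by rewrite (_ : 1 + 1 - 2 = 0) ?mulr0 ?mgf0 ?expr1n ?mulr1 //; ring.
rewrite -hE // -[RHS]h1.
have dh z : z \in `]1, y[ -> is_derive z 1 h 0.
  rewrite in_itv /= => /andP[z1 _].
  apply: (near_eq_is_derive _ (is_derive_mgf_bridge z1)).
  near=> x; rewrite hE //.
  by near: x; apply: lt_nbhsr; exact: lt_trans z1.
have ch : {within `[1, y], continuous h}.
  apply/continuous_in_subspaceT => z; rewrite inE /= in_itv /= => /andP[z1 _].
  have z0 : 0 < z by exact: lt_le_trans z1.
  have cs : {for z, continuous s}.
    apply/differentiable_continuous/derivable1_diffP.
    by case: (is_derive_bridge_param n z0).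
  apply: cvgM; last exact: continuous_mean_power.
  have cm := continuous_comp cs (@continuous_mgf_norm _ _ _ P X _ _ K_psd (s z)).
  exact: (continuous_comp cm (@exprn_continuous _ 2 _)).
have [c _] := MVT y1 dh ch.
by rewrite mul0r => /eqP; rewrite subr_eq0 => /eqP.
Unshelve. all: end_near. Qed.

End BridgeMgf.

(** * The second moment as a double integral *)

Section ExponentialWeights.
Context {R : realType}.
Local Notation mu := (@lebesgue_measure R).

(** The indicator of the positive half-line is built in, so that Tonelli is applied on the whole
    line. *)
Definition expweight (q s : R) : R := (0 < s)%R%:R * expR (- (s / 2 * q)).

Lemma expweight_ge0 q s : 0 <= expweight q s.
Proof. by rewrite mulr_ge0 ?expR_ge0. Qed.

Lemma measurable_expweight d (T : measurableType d) (q s : T -> R) :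
  measurable_fun [set: T] q -> measurable_fun [set: T] s ->
  measurable_fun [set: T] (fun w => expweight (q w) (s w)).
Proof.
move=> mq ms; apply: measurable_funM.
  have -> : (fun w => (0 < s w)%R%:R) = (\1_[set x : R | 0 < x] : R -> R) \o s.
    apply/funext => w; rewrite /= indicE; congr ((nat_of_bool _)%:R).
    by apply/idP/idP => [s0|/set_mem //]; exact: mem_set.
  apply: measurableT_comp ms; apply: measurable_indic.
  rewrite -(set_itv_o_infty (0 : R)) //; exact: measurable_itv.
apply: measurableT_comp => //; apply: measurableT_comp => //.
by apply: measurable_funM => //; apply: measurable_funM.
Qed.

(** For positive [s] the weight is [2 / q] times the exponential density of rate [q / 2]. *)
Lemma integral_expweight (q : R) : 0 < q -> (\int[mu]_s (expweight q s)%:E = (2 / q)%:E)%E.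
Proof.
move=> q0; have r0 : 0 < q / 2 by rewrite divr_gt0.
have cE : continuous (fun s : R => expR (- (s / 2 * q))).
  move=> s; apply: (@continuous_comp _ _ _ (fun s : R => - (s / 2 * q)) expR).
    by apply/differentiable_continuous/derivable1_diffP; exact: ex_derive.
  exact: continuous_expR.
have := integral_exponential_pdf r0.
have -> : (fun x => (exponential_pdf (q / 2) x)%:E) =
    (EFin \o (fun x => q / 2 * expR (- (q / 2) * x))) \_ `[0, +oo[.
  by rewrite restrict_EFin.
rewrite -integral_mkcond.
rewrite -integral_itv_obnd_cbnd; last first.
  apply/measurable_EFinP; apply: measurable_funTS.
  by apply: measurable_funM => //; apply: measurableT_comp.
have -> : (\int[mu]_s (expweight q s)%:E =
    \int[mu]_(s in `]0%R, +oo[) (expR (- (s / 2 * q)))%:E)%E.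
  rewrite [RHS]integral_mkcond; apply: eq_integral => s _.
  rewrite patchE /expweight; case: ifPn => [|] /=.
    by rewrite inE /= in_itv /= andbT => ->; rewrite mul1r.
  rewrite notin_setE /= in_itv /= andbT => /negP/negbTE ->.
  by rewrite mul0r.
have -> : (\int[mu]_(s in `]0%R, +oo[) (EFin \o (fun x => q / 2 * expR (- (q / 2) * x))%R) s =
    \int[mu]_(s in `]0%R, +oo[) ((q / 2)%:E * (expR (- (s / 2 * q)))%:E))%E.
  by apply: eq_integral => s _; rewrite /= EFinM; congr (_ * (expR _)%:E)%E; field.
rewrite ge0_integralZl //; last 2 first.
- by apply/measurable_EFinP; apply: measurable_funTS; exact: continuous_measurable_fun.
- by rewrite lee_fin ltW.
set I := (\int[mu]_(x in _) _)%E => E.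
have I0 : (0 <= I)%E by apply: integral_ge0 => s _; rewrite lee_fin expR_ge0.
(* The integral could a priori be infinite; [q / 2] times it being 1 excludes that. *)
move: E I0; case: I => [i| |] //.
  move=> [] E _; congr (_%:E).
  apply: (@mulfI _ (q / 2)); first by rewrite gt_eqF.
  by rewrite E; field; rewrite gt_eqF.
by rewrite gt0_muley // lte_fin.
Qed.

End ExponentialWeights.

Section Tonelli.
Context d (T : measurableType d) (R : realType) (P : probability T R).
Local Notation mu := (@lebesgue_measure R).
Variables (b p q : T -> R).
Hypotheses (mb : measurable_fun [set: T] b) (mp : measurable_fun [set: T] p)
  (mq : measurable_fun [set: T] q).
Hypotheses (p_ge0 : forall w, 0 <= p w) (q_ge0 : forall w, 0 <= q w).
Hypotheses (p_eq0 : forall w, p w = 0 -> b w = 0)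
  (q_eq0 : forall w, q w = 0 -> b w = 0).

(** The factor [4^-1] cancels the product of the two integrals [2 / p] and [2 / q]. *)
Definition ratio_kernel (z : (measurableTypeR R * measurableTypeR R) * T) : R :=
  4^-1 * b z.2 ^+ 2 * (expweight (p z.2) z.1.1 * expweight (q z.2) z.1.2).

Lemma ratio_kernel_ge0 z : 0 <= ratio_kernel z.
Proof.
apply: mulr_ge0; last by apply: mulr_ge0; exact: expweight_ge0.
by apply: mulr_ge0; [rewrite invr_ge0|exact: sqr_ge0].
Qed.

Lemma measurable_ratio_kernel :
  measurable_fun [set: (measurableTypeR R * measurableTypeR R) * T] ratio_kernel.
Proof.
have m2 (g : T -> R) : measurable_fun [set: T] g ->
    measurable_fun [set: (measurableTypeR R * measurableTypeR R) * T]
    (fun z => g z.2).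
  by move=> mg; exact: measurableT_comp mg (measurable_snd).
have m1 : measurable_fun [set: (measurableTypeR R * measurableTypeR R) * T]
    (fun z => z.1.1 : measurableTypeR R).
  exact: measurableT_comp measurable_fst measurable_fst.
have m1' : measurable_fun [set: (measurableTypeR R * measurableTypeR R) * T]
    (fun z => z.1.2 : measurableTypeR R).
  exact: measurableT_comp measurable_snd measurable_fst.
apply: measurable_funM.
  by apply: measurable_funM => //; apply: measurable_funX; exact: m2.
apply: measurable_funM; apply: measurable_expweight; [exact: m2| |exact: m2|].
- by move=> mT A mA; exact: m1.
- by move=> mT A mA; exact: m1'.
Qed.

Lemma integral_ratio_kernel w :
  (\int[(mu \x mu)%E]_s (ratio_kernel (s, w))%:E = (b w ^+ 2 / (p w * q w))%:E)%E.
Proof.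
have mk : measurable_fun [set: measurableTypeR R * measurableTypeR R]
    (fun s => (ratio_kernel (s, w))%:E).
  apply/measurable_EFinP; apply: (measurableT_comp measurable_ratio_kernel).
  exact: measurable_fun_pair.
(* If [b w] is 0, both sides are 0, whatever [p w] and [q w]. Otherwise both denominators are
   positive and the weights integrate to finite values. *)
have [b0|b0] := eqVneq (b w) 0.
  rewrite b0 expr0n mul0r; apply: integral0_eq => s _.
  by rewrite /ratio_kernel /= b0 expr0n mulr0 mul0r.
have pw : 0 < p w by rewrite lt_def p_ge0 andbT; apply: contra_neq b0 => /p_eq0.
have qw : 0 < q w by rewrite lt_def q_ge0 andbT; apply: contra_neq b0 => /q_eq0.
rewrite fubini_tonelli1 //; last by move=> s; rewrite lee_fin ratio_kernel_ge0.
have mw (r : R) : measurable_fun [set: measurableTypeR R] (fun s => (expweight r s)%:E).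
  by apply/measurable_EFinP; apply: measurable_expweight.
have c0 : (0 <= (4^-1 * b w ^+ 2 * (2 / q w))%:E)%E.
  rewrite lee_fin; apply: mulr_ge0; last by rewrite divr_ge0 // ltW.
  by rewrite mulr_ge0 ?invr_ge0 ?sqr_ge0.
transitivity (\int[mu]_s
    ((4^-1 * b w ^+ 2 * (2 / q w))%:E * (expweight (p w) s)%:E))%E.
  apply: eq_integral => s _; rewrite /fubini_F /ratio_kernel /=.
  under eq_integral do rewrite mulrA EFinM.
  rewrite ge0_integralZl //.
  - by rewrite integral_expweight // -!EFinM; congr (_%:E); ring.
  - by move=> t _; rewrite lee_fin expweight_ge0.
  - rewrite lee_fin; apply: mulr_ge0; last exact: expweight_ge0.
    by rewrite mulr_ge0 ?invr_ge0 ?sqr_ge0.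
rewrite ge0_integralZl //.
- rewrite integral_expweight // -EFinM; congr (_%:E).
  by field; rewrite !gt_eqF.
- by move=> s _; rewrite lee_fin expweight_ge0.
Qed.

Definition ratio_density (s : measurableTypeR R * measurableTypeR R) : \bar R :=
  (\int[P]_w (ratio_kernel (s, w))%:E)%E.

Let mk : measurable_fun [set: (measurableTypeR R * measurableTypeR R) * T]
  (fun z => (ratio_kernel z)%:E).
Proof. by apply/measurable_EFinP; exact: measurable_ratio_kernel. Qed.

Let k0 z : (0 <= (ratio_kernel z)%:E)%E.
Proof. by rewrite lee_fin ratio_kernel_ge0. Qed.

Lemma measurable_ratio_density :
  measurable_fun [set: measurableTypeR R * measurableTypeR R] ratio_density.
Proof.
have H := @measurable_fun_fubini_tonelli_F _ _ _ _ R P _ mk k0.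
exact: H.
Qed.

(* The product of two Lebesgue measures is not inferred to be sigma-finite, so
   the two time variables are exchanged with [P] one after the other. *)
Lemma integral_ratio :
  (\int[P]_w (b w ^+ 2 / (p w * q w))%:E =
   \int[(mu \x mu)%E]_s ratio_density s)%E.
Proof.
pose k1 (z : measurableTypeR R * T * measurableTypeR R) :=
  (ratio_kernel ((z.1.1, z.2), z.1.2))%:E.
have mk1 : measurable_fun [set: measurableTypeR R * T * measurableTypeR R] k1.
  apply: (measurableT_comp mk); apply: measurable_fun_pair.
    apply: measurable_fun_pair => //.
    exact: measurableT_comp measurable_fst measurable_fst.
  exact: measurableT_comp measurable_snd measurable_fst.
have mF := @measurable_fun_fubini_tonelli_F _ _ _ _ R mu _ mk1 (fun z => k0 _).
rewrite fubini_tonelli1; last 2 first.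
- exact: measurable_ratio_density.
- by move=> s; apply: integral_ge0.
transitivity (\int[P]_w \int[mu]_s fubini_F mu k1 (s, w))%E.
  apply: eq_integral => w _; rewrite -integral_ratio_kernel fubini_tonelli1 //.
  apply: (measurableT_comp mk); exact: measurable_fun_pair.
rewrite -(@fubini_tonelli _ _ _ _ R mu P _ mF); last first.
  by move=> z; apply: integral_ge0 => s _; exact: k0.
apply: eq_integral => s _; rewrite /fubini_F /ratio_density /k1 /=.
pose k2 (z : T * measurableTypeR R) := (ratio_kernel ((s, z.2), z.1))%:E.
apply: (@fubini_tonelli _ _ _ _ R P mu k2) => [|z]; last exact: k0.
apply: (measurableT_comp mk); apply: measurable_fun_pair => //.
by apply: measurable_fun_pair.
Qed.

End Tonelli.

(** The indices form a closed cycle [p.1], [p.2], [q.2], [q.1], joined by [K], [N], [K], [M]. Here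
    [p] and [q] index the two factors of a squared bilinear form. *)
Lemma trace_mulmx2 (F : comRingType) (m : nat) (K M N : 'M[F]_m) :
  (forall j k, K j k = K k j) -> (forall j k, M j k = M k j) ->
  \sum_(p : 'I_m * 'I_m) \sum_(q : 'I_m * 'I_m)
    K p.1 p.2 * K q.1 q.2 * (M p.1 q.1 * N p.2 q.2) =
  \tr ((K *m M) *m (K *m N)).
Proof.
move=> K_sym M_sym; rewrite mxtrace_mulC /mxtrace.
rewrite -(pair_bigA _ (fun j k => \sum_(q : 'I_m * 'I_m) K j k * K q.1 q.2 *
  (M j q.1 * N k q.2))) /=.
apply: eq_bigr => j _; rewrite mxE.
transitivity (\sum_k \sum_c \sum_i K j k * N k c * (K c i * M i j)).
  apply: eq_bigr => k _; rewrite exchange_big /=.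
  rewrite -(pair_bigA _ (fun i c => K j k * K i c * (M j i * N k c))) /=.
  apply: eq_bigr => i _; apply: eq_bigr => c _.
  rewrite (M_sym j i) (K_sym i c); ring.
rewrite exchange_big /=; apply: eq_bigr => c _.
rewrite !mxE mulr_suml; apply: eq_bigr => k _.
by rewrite mulr_sumr.
Qed.

Section RatioDensity.
Context d (T : measurableType d) (R : realType) (P : probability T R).
Variables (X Y : nat -> {RV P >-> R}) (m : nat) (K : 'M[R]_m).
Hypotheses (X_gauss : forall k, standard_gaussian (X k))
  (Y_gauss : forall k, standard_gaussian (Y k))
  (XY_indep : independent_sequences X Y).
Hypotheses (K_sym : forall j k, K j k = K k j)
  (K_psd : forall x, 0 <= bform K x x).

Local Notation x w := (increments X w).
Local Notation y w := (increments Y w).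

(** Measurability for the sigma-algebra of [Z] alone is what the independence of the two sequences
    asks for. *)
Lemma measurable_moment_sequence (Z : nat -> {RV P >-> R}) (s : R) (j k : 'I_m) :
  measurable_fun [set: sequence_space Z]
    (fun w => increments Z w j * increments Z w k * damping Z K s w).
Proof.
have mZ (i : 'I_m) : measurable_fun [set: sequence_space Z]
    (fun w => increments Z w i : R).
  exact: measurable_coordinate.
apply: measurable_funM; first exact: measurable_funM.
apply: measurableT_comp => //; apply: measurableT_comp => //.
by apply: measurable_funM => //; exact: measurable_bform.
Qed.

Lemma integral_moments (s t : R) (j j' k k' : 'I_m) : 0 <= s -> 0 <= t ->
  P.-integrable [set: T] (fun w => ((x w j * x w j' * damping X K s w) *
     (y w k * y w k' * damping Y K t w))%:E) /\
  (\int[P]_w ((x w j * x w j' * damping X K s w) *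
     (y w k * y w k' * damping Y K t w))%:E =
   (moment_mx X K s j j' * moment_mx Y K t k k')%:E)%E.
Proof.
move=> s0 t0.
have iX := integrable_moment X_gauss K_psd j j' s0.
have iY := integrable_moment Y_gauss K_psd k k' t0.
have mX := measurable_int _ iX; have mY := measurable_int _ iY.
have [] := independent_integralM (P := P) (proj1 (measurable_EFinP _ _) mX)
  (proj1 (measurable_EFinP _ _) mY)
  (independent_sequences_maps XY_indep (measurable_moment_sequence s j j')
    (measurable_moment_sequence t k k')) iX iY.
move=> iXY ->; split => //.
rewrite EFinM (integral_moment X_gauss K_psd j j' s0).
by rewrite (integral_moment Y_gauss K_psd k k' t0).
Qed.

Lemma bform_sqr_damping (s t : R) w :
  bform K (x w) (y w) ^+ 2 * (damping X K s w * damping Y K t w) =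
  \sum_(p : 'I_m * 'I_m) \sum_(q : 'I_m * 'I_m) (K p.1 p.2 * K q.1 q.2) *
    ((x w p.1 * x w q.1 * damping X K s w) * (y w p.2 * y w q.2 * damping Y K t w)).
Proof.
rewrite /bform pair_bigA /= expr2 mulr_suml mulr_suml; apply: eq_bigr => p _.
rewrite mulr_sumr mulr_suml; apply: eq_bigr => q _; ring.
Qed.

Lemma integral_bform_sqr (s t : R) : 0 <= s -> 0 <= t ->
  (\int[P]_w (bform K (x w) (y w) ^+ 2 * (damping X K s w * damping Y K t w))%:E =
   (\tr ((K *m moment_mx X K s) *m (K *m moment_mx Y K t)))%:E)%E.
Proof.
move=> s0 t0.
under eq_integral do rewrite bform_sqr_damping -sumEFin.
under eq_integral do under eq_bigr do rewrite -sumEFin.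
have iK (p q : 'I_m * 'I_m) : P.-integrable [set: T] (fun w =>
    (K p.1 p.2 * K q.1 q.2 * ((x w p.1 * x w q.1 * damping X K s w) *
      (y w p.2 * y w q.2 * damping Y K t w)))%:E).
  under eq_fun do rewrite EFinM; apply: integrableZl => //.
  by have [] := integral_moments p.1 q.1 p.2 q.2 s0 t0.
rewrite integral_sum //; last by move=> p; apply: integrable_sum.
under eq_bigr do rewrite integral_sum //.
under eq_bigr do under eq_bigr do (under eq_integral do rewrite EFinM).
have E (p q : 'I_m * 'I_m) : (\int[P]_w ((K p.1 p.2 * K q.1 q.2)%:E *
   ((x w p.1 * x w q.1 * damping X K s w) * (y w p.2 * y w q.2 * damping Y K t w))%:E) =
   (K p.1 p.2 * K q.1 q.2 * (moment_mx X K s p.1 q.1 * moment_mx Y K t p.2 q.2))%:E)%E.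
  have [iM EM] := integral_moments p.1 q.1 p.2 q.2 s0 t0.
  by rewrite integralZl // EM -EFinM.
under eq_bigr do under eq_bigr do rewrite E.
under eq_bigr do rewrite sumEFin.
rewrite sumEFin; congr (_%:E).
apply: trace_mulmx2 => // j k; exact: moment_mx_sym.
Qed.

End RatioDensity.

(** * The integrand in closed form *)

Section IntegrandAlgebra.
Context {R : realType}.

Lemma powR_expn (x : R) (k l : nat) : 0 < x -> (0 < k)%N ->
  (x ^+ k) `^ (l%:R / k%:R) = x ^+ l.
Proof.
move=> x0 k0; rewrite -!powR_mulrn ?ltW // -powRrM mulrC divfK //.
by rewrite pnatr_eq0 -lt0n.
Qed.

Lemma powR_expnN (x : R) (k l : nat) : 0 < x -> (0 < k)%N ->
  (x ^+ k) `^ (- (l%:R / k%:R)) = x ^- l.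
Proof. by move=> x0 k0; rewrite powRN powR_expn. Qed.

(** [f x] is the larger root of [y^2 - (x + 2) y + 1]; the other root is its inverse, obtained by
    changing the sign of the square root. *)
Lemma fP (x : R) : 0 < x ->
  [/\ 1 < f x, f x + (f x)^-1 = x + 2 &
      f x - (f x)^-1 = Num.sqrt (x ^+ 2 + 4 * x)].
Proof.
move=> x0; rewrite /f (_ : (x + 2) ^+ 2 - 4 = x ^+ 2 + 4 * x); last by ring.
set e := Num.sqrt _.
have e2 : e ^+ 2 = x ^+ 2 + 4 * x.
  by rewrite sqr_sqrtr // addr_ge0 ?sqr_ge0 // mulr_ge0 // ltW.
have e0 : 0 <= e by exact: sqrtr_ge0.
have V : (((x + 2) + e) / 2)^-1 = ((x + 2) - e) / 2.
  apply: (@mulfI _ (((x + 2) + e) / 2)); first by rewrite gt_eqF //; nra.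
  rewrite divff; last by rewrite gt_eqF //; nra.
  by apply: (@mulfI _ 4) => //; field: e2.
by rewrite V; split; [nra|field|field].
Qed.

(* Here [p = y + y^-1], [d = y - y^-1] and [F = y ^+ n], so that
   [s = N * (p - 2)], [Num.sqrt (s ^+ 2 + 4 * N * s) = N * d] and
   [2 * y = p + d]; the only relation needed is [d ^+ 2 = p ^+ 2 - 4]. *)
Lemma trace_algebra (N p1 d1 p2 d2 F1 F2 : R) :
  N != 0 -> d1 != 0 -> d2 != 0 -> d1 + d2 != 0 -> p1 - p2 != 0 ->
  (p1 - p2) + (d1 - d2) != 0 -> F1 != 0 -> F2 != 0 ->
  F1 - F1^-1 != 0 -> F2 - F2^-1 != 0 ->
  d1 ^+ 2 = p1 ^+ 2 - 4 -> d2 ^+ 2 = p2 ^+ 2 - 4 ->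
  let U1 := F1 - F1^-1 in let U2 := F2 - F2^-1 in
  (((F1 + F1^-1) / (d1 * U1) - p1 / (N * d1 ^+ 2)) -
   ((F2 + F2^-1) / (d2 * U2) - p2 / (N * d2 ^+ 2))) / (N * (p2 - p1)) =
  - ((N * p1) * (N * p2) + 4 * N ^+ 2) / (N * d1 * (N * d2)) ^+ 2 +
  (N * (N * (p1 + p2)) / (N * d1 + N * d2) * (F1 * F2 - F1^-1 * F2^-1) +
   1 / 2 * (N * d1 + N * d2 + N * (p1 + p2)) *
     ((F1 * F2^-1 - F2 * F1^-1) / ((p1 - p2 + (d1 - d2)) / 2)))
  / (U1 * U2 * (N * d1 * (N * d2))).
Proof.
move=> N0 d10 d20 d0 p0 pd0 F10 F20 U10 U20 e1 e2 U1 U2.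
have p0' : p2 - p1 != 0 by rewrite -opprB oppr_eq0.
(* The relations give [d1^2 - d2^2 = p1^2 - p2^2], which trades the denominators of the statement
   for the difference [p1 - p2]. *)
have A1 : (p1 + p2) / (d1 + d2) = (d1 - d2) / (p1 - p2).
  apply/eqP; rewrite eqr_div //; apply/eqP.
  by transitivity (p1 ^+ 2 - 4 - (p2 ^+ 2 - 4)); [ring|rewrite -e1 -e2; ring].
have A2 : (d1 + d2 + (p1 + p2)) / ((p1 - p2 + (d1 - d2)) / 2) =
    2 * (d1 + d2) / (p1 - p2).
  rewrite invf_div mulrA; apply/eqP; rewrite eqr_div //; apply/eqP.
  transitivity (2 * ((d1 + d2) * (p1 - p2) + (p1 ^+ 2 - 4 - (p2 ^+ 2 - 4)))).
    ring.
  rewrite -e1 -e2; ring.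
have -> : N * (N * (p1 + p2)) / (N * d1 + N * d2) = N * ((p1 + p2) / (d1 + d2)).
  by field; rewrite d0 -mulrDr mulf_neq0.
have -> : 1 / 2 * (N * d1 + N * d2 + N * (p1 + p2)) *
     ((F1 * F2^-1 - F2 * F1^-1) / ((p1 - p2 + (d1 - d2)) / 2)) =
   N / 2 * ((d1 + d2 + (p1 + p2)) / ((p1 - p2 + (d1 - d2)) / 2)) *
   (F1 * F2^-1 - F2 * F1^-1).
  by field; rewrite F10 F20 pd0.
rewrite A1 A2.
(* The part free of [F1] and [F2]: the first integrand collects the second terms of the two traces,
   and the second integrand their first terms. *)
have A3 : - ((N * p1) * (N * p2) + 4 * N ^+ 2) / (N * d1 * (N * d2)) ^+ 2 =
    (- (p1 / (N * d1 ^+ 2)) + p2 / (N * d2 ^+ 2)) / (N * (p2 - p1)).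
  have -> : (- (p1 / (N * d1 ^+ 2)) + p2 / (N * d2 ^+ 2)) / (N * (p2 - p1)) =
      (p2 * d1 ^+ 2 - p1 * d2 ^+ 2) / (N ^+ 2 * (p2 - p1) * (d1 * d2) ^+ 2).
    by field; rewrite p0' d10 d20 N0.
  rewrite e1 e2; field.
  by rewrite p0' d10 d20 N0.
rewrite A3 /U1 /U2.
have -> : p1 - p2 = - (p2 - p1) by ring.
move: (p2 - p1) p0' => q q0.
move: U10 U20.
have -> : F1 - F1^-1 = (F1 * F1 - 1) / F1 by field.
have -> : F2 - F2^-1 = (F2 * F2 - 1) / F2 by field.
rewrite !mulf_eq0 !negb_or => /andP[U10 _] /andP[U20 _].
by field; rewrite ?U10 ?U20 ?F10 ?F20 ?d10 ?d20 ?N0 ?q0.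
Qed.

End IntegrandAlgebra.

Section IntegrandValue.
Context {R : realType} (m : nat).
Local Notation n := m.+1.
Local Notation N := (n%:R : R).

Lemma bridge_paramK (s : R) : 0 < s -> bridge_param n (f (s / N)) = s.
Proof.
move=> s0; have [_ E _] := fP (divr_gt0 s0 (ltr0Sn R m)).
by rewrite /bridge_param E addrK mulrC divfK // pnatr_eq0.
Qed.

Lemma sqrt_scaled (s : R) : 0 < s ->
  Num.sqrt (s ^+ 2 + 4 * N * s) = N * powdiff (f (s / N)) 1.
Proof.
move=> s0; have N0 : 0 < N by rewrite ltr0Sn.
have [_ _ E] := fP (divr_gt0 s0 N0).
rewrite /powdiff expr1 E.
have -> : s ^+ 2 + 4 * N * s = N ^+ 2 * ((s / N) ^+ 2 + 4 * (s / N)).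
  by move: N N0 => M M0; field; rewrite gt_eqF.
by rewrite sqrtrM ?sqr_ge0 // sqrtr_sqr ger0_norm // ltW.
Qed.

Lemma f_inj (s t : R) : 0 < s -> 0 < t -> f (s / N) = f (t / N) -> s = t.
Proof. by move=> s0 t0 E; rewrite -(bridge_paramK s0) E bridge_paramK. Qed.

(** Off the diagonal the resolvent identity divides by [t - s], and the two relations determine
    [phi] and [psi] because they are nonnegative. *)
Lemma second_moment_integrandE (s t phi psi : R) :
  0 < s -> 0 < t -> s != t -> 0 <= phi -> 0 <= psi ->
  phi ^+ 2 * mean_power (f (s / N)) n = 1 ->
  psi ^+ 2 * mean_power (f (t / N)) n = 1 ->
  4^-1 * (phi * psi * \tr (bridge_resolvent m (f (s / N)) *m
                           bridge_resolvent m (f (t / N)))) =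
  second_moment_integrand n s t.
Proof.
move=> s0 t0 st phi0 psi0.
have N0 : 0 < N by rewrite ltr0Sn.
have nn : N != 0 by rewrite gt_eqF.
rewrite /second_moment_integrand /integrand1 /integrand2 /=.
rewrite (sqrt_scaled s0) (sqrt_scaled t0).
have Sy := bridge_paramK s0; have Ty := bridge_paramK t0.
have [y1 ys yd] := fP (divr_gt0 s0 N0); have [z1 zs zd] := fP (divr_gt0 t0 N0).
have yz : f (s / N) != f (t / N) by apply: contra_neq st => /(f_inj s0 t0).
move: (f (s / N)) (f (t / N)) Sy Ty y1 ys yd z1 zs zd yz => y z Sy Ty y1 ys yd z1 zs zd yz.
have y0 : 0 < y by exact: lt_trans y1.
have z0 : 0 < z by exact: lt_trans z1.
have yn : y != 0 by rewrite gt_eqF.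
have zn : z != 0 by rewrite gt_eqF.
have d1 := powdiff_gt0 (ltn0Sn 0) y1; have d2 := powdiff_gt0 (ltn0Sn 0) z1.
have U1 := powdiff_gt0 (ltn0Sn m) y1; have U2 := powdiff_gt0 (ltn0Sn m) z1.
move=> phiE psiE.
have tau : \tr (bridge_resolvent m y *m bridge_resolvent m z) =
    (\tr (bridge_resolvent m y) - \tr (bridge_resolvent m z)) / (t - s).
  apply: (@mulfI _ (t - s)); first by rewrite subr_eq0 eq_sym.
  rewrite [RHS]mulrC divfK ?subr_eq0 1?eq_sym //.
  apply: (@resolvent_trace _ _ (bridge_mx m)).
  - by rewrite -Sy; apply: bridge_resolventE; rewrite // gt_eqF.
  - by rewrite -Ty; apply: bridge_resolventE; rewrite // gt_eqF.
rewrite tau (bridge_resolvent_trace nn yn) ?gt_eqF //.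
rewrite (bridge_resolvent_trace nn zn) ?gt_eqF //.
have rs : (N * powdiff y 1) ^+ 2 = s * (s + 4 * N).
  rewrite /powdiff expr1 -Sy /bridge_param; move: N nn => M M0.
  by field.
have rt : (N * powdiff z 1) ^+ 2 = t * (t + 4 * N).
  rewrite /powdiff expr1 -Ty /bridge_param; move: N nn => M M0.
  by field.
(* In terms of these roots every fractional power becomes an integral one: [phi = b / a],
   [psi = e / c], and the product of the four linear factors is [(b e)^4]. *)
pose a := Num.sqrt (powdiff y n); pose c := Num.sqrt (powdiff z n).
pose b := Num.sqrt (N * powdiff y 1); pose e := Num.sqrt (N * powdiff z 1).
have a0 : 0 < a by rewrite sqrtr_gt0.
have c0 : 0 < c by rewrite sqrtr_gt0.
have b0 : 0 < b by rewrite sqrtr_gt0 mulr_gt0.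
have e0 : 0 < e by rewrite sqrtr_gt0 mulr_gt0.
have a2 : powdiff y n = a ^+ 2 by rewrite sqr_sqrtr // ltW.
have c2 : powdiff z n = c ^+ 2 by rewrite sqr_sqrtr // ltW.
have b2 : N * powdiff y 1 = b ^+ 2 by rewrite sqr_sqrtr // mulr_ge0 // ltW.
have e2 : N * powdiff z 1 = e ^+ 2 by rewrite sqr_sqrtr // mulr_ge0 // ltW.
have phib : phi = b / a.
  apply/eqP; rewrite -(@eqrXn2 _ 2) // ?divr_ge0 ?ltW //; apply/eqP.
  have : powdiff y 1 * mean_power y n = N^-1 * powdiff y n by exact: mean_powerE.
  rewrite a2 => E; rewrite expr_div_n -b2.
  apply: (@mulIf _ (mean_power y n)).
    by apply: contra_eq_neq phiE => ->; rewrite mulr0 eq_sym oner_neq0.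
  rewrite phiE mulrAC -(mulrA N) E.
  by move: N nn => M M0; field; rewrite M0 gt_eqF.
have psib : psi = e / c.
  apply/eqP; rewrite -(@eqrXn2 _ 2) // ?divr_ge0 ?ltW //; apply/eqP.
  have : powdiff z 1 * mean_power z n = N^-1 * powdiff z n by exact: mean_powerE.
  rewrite c2 => E; rewrite expr_div_n -e2.
  apply: (@mulIf _ (mean_power z n)).
    by apply: contra_eq_neq psiE => ->; rewrite mulr0 eq_sym oner_neq0.
  rewrite psiE mulrAC -(mulrA N) E.
  by move: N nn => M M0; field; rewrite M0 gt_eqF.
have prod4 : s * t * (s + 4 * N) * (t + 4 * N) = (b * e) ^+ 4.
  transitivity ((s * (s + 4 * N)) * (t * (t + 4 * N))); first ring.
  rewrite -rs -rt b2 e2; ring.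
have be0 : 0 < b * e by exact: mulr_gt0.
rewrite prod4 -/(powdiff y n) -/(powdiff z n) a2 c2.
rewrite (@powR_expn _ (b * e) 4 3 be0) // (@powR_expnN _ (b * e) 4 1 be0) //.
rewrite (@powR_expnN _ a 2 1 a0) // (@powR_expnN _ a 2 3 a0) //.
rewrite (@powR_expnN _ c 2 1 c0) // (@powR_expnN _ c 2 3 c0) //.
pose p1 := powsum y 1; pose p2 := powsum z 1.
have ps : s = N * (p1 - 2) by rewrite -Sy /bridge_param /p1 /powsum expr1.
have pt : t = N * (p2 - 2) by rewrite -Ty /bridge_param /p2 /powsum expr1.
have p12 : p1 - p2 != 0.
  by apply: contra_neq st => /eqP; rewrite subr_eq0 ps pt => /eqP ->.
have yzE : y - z = (p1 - p2 + (powdiff y 1 - powdiff z 1)) / 2.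
  by rewrite /p1 /p2 /powsum /powdiff !expr1; field; rewrite yn zn.
have yz0 : p1 - p2 + (powdiff y 1 - powdiff z 1) != 0.
  apply: contra_neq yz => E; apply/eqP.
  by rewrite -subr_eq0 yzE E mul0r.
have q1 : powdiff y 1 ^+ 2 = p1 ^+ 2 - 4.
  by rewrite /p1 /powsum /powdiff !expr1; field.
have q2 : powdiff z 1 ^+ 2 = p2 ^+ 2 - 4.
  by rewrite /p2 /powsum /powdiff !expr1; field.
have := @trace_algebra R N p1 (powdiff y 1) p2 (powdiff z 1) (y ^+ n) (z ^+ n)
  nn (lt0r_neq0 d1) (lt0r_neq0 d2) (lt0r_neq0 (addr_gt0 d1 d2)) p12 yz0
  (expf_neq0 n yn) (expf_neq0 n zn) (lt0r_neq0 U1) (lt0r_neq0 U2) q1 q2.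
rewrite /= -/(powdiff y n) -/(powdiff z n) -/(powsum y n) -/(powsum z n) a2 c2.
have -> : N * (p2 - p1) = t - s by rewrite ps pt; ring.
rewrite -/p1 -/p2 => ->.
have -> : N * p1 = s + 2 * N by rewrite ps; ring.
have -> : N * p2 = t + 2 * N by rewrite pt; ring.
have -> : N * (p1 + p2) = s + t + 4 * N by rewrite ps pt; ring.
rewrite -yzE b2 e2 phib psib -(addrA _ s t) -(addrA _ (s + t)) !addrA expr1.
set W1 := _ * _ + 4 * _; set W2 := _ * (_ - _) + _ * (_ / _).
move: W1 W2 => W1 W2; field.
by rewrite !gt_eqF.
Qed.

End IntegrandValue.

(** * Measurability of the closed-form integrand *)

Section Measurability.
Context d (T : measurableType d) (R : realType).
Implicit Types g s t : T -> R.

Lemma measurable_funV g : measurable_fun [set: T] g ->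
  measurable_fun [set: T] (fun w => (g w)^-1).
Proof.
move=> mg.
(* [powR] with exponent -1 is the inverse on nonnegative bases, hence the square; at a zero of [g]
   both sides are 0. *)
have -> : (fun w => (g w)^-1) = (fun w => g w * (g w ^+ 2) `^ (-1)).
  apply/funext => w; have [->|g0] := eqVneq (g w) 0; first by rewrite invr0 mul0r.
  rewrite powR_inv1 ?sqr_ge0 //; field.
  by rewrite g0.
apply: measurable_funM => //.
apply: (measurableT_comp (measurable_powR (-1))).
exact: measurable_funX.
Qed.

Lemma measurable_fun_sqrt g : measurable_fun [set: T] g ->
  measurable_fun [set: T] (fun w => Num.sqrt (g w)).
Proof.
move=> mg; apply: measurableT_comp mg.
apply: continuous_measurable_fun.
exact: sqrt_continuous.
Qed.

Lemma measurable_fun_powR g (a : R) : measurable_fun [set: T] g ->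
  measurable_fun [set: T] (fun w => g w `^ a).
Proof. by move=> mg; exact: (measurableT_comp (measurable_powR a) mg). Qed.

Lemma measurable_fun_f g : measurable_fun [set: T] g ->
  measurable_fun [set: T] (fun w => f (g w)).
Proof.
move=> mg; apply: measurable_funM => //; apply: measurable_funD.
  exact: measurable_funD.
apply: measurable_fun_sqrt; apply: measurable_funB => //.
by apply: measurable_funX; exact: measurable_funD.
Qed.

Lemma measurable_second_moment_integrand (n : nat) s t :
  measurable_fun [set: T] s -> measurable_fun [set: T] t ->
  measurable_fun [set: T] (fun w => second_moment_integrand n (s w) (t w)).
Proof.
move=> ms mt.
have mc (c : R) : measurable_fun [set: T] (cst c) by exact: measurable_cst.
have mfs : measurable_fun [set: T] (fun w => f (s w / n%:R)).
  by apply: measurable_fun_f; exact: measurable_funM.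
have mft : measurable_fun [set: T] (fun w => f (t w / n%:R)).
  by apply: measurable_fun_f; exact: measurable_funM.
have mX g : measurable_fun [set: T] g ->
    measurable_fun [set: T] (fun w => g w ^+ n) by exact: measurable_funX.
have mXV g : measurable_fun [set: T] g ->
    measurable_fun [set: T] (fun w => g w ^- n).
  by move=> mg; apply: measurable_funV; exact: measurable_funX.
have mD4 g : measurable_fun [set: T] g ->
    measurable_fun [set: T] (fun w => g w + 4 * n%:R).
  by move=> mg; exact: measurable_funD.
have mdiff a g : measurable_fun [set: T] g ->
    measurable_fun [set: T] (fun w => (g w ^+ n - g w ^- n) `^ a).
  by move=> mg; apply: measurable_fun_powR; apply: measurable_funB; auto.
have mprod a : measurable_fun [set: T]
    (fun w => (s w * t w * (s w + 4 * n%:R) * (t w + 4 * n%:R)) `^ a).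
  apply: measurable_fun_powR; apply: measurable_funM; last exact: mD4.
  by apply: measurable_funM; [exact: measurable_funM|exact: mD4].
have mr g : measurable_fun [set: T] g ->
    measurable_fun [set: T] (fun w => Num.sqrt (g w ^+ 2 + 4 * n%:R * g w)).
  move=> mg; apply: measurable_fun_sqrt; apply: measurable_funD.
    exact: measurable_funX.
  exact: measurable_funM.
have mrs := mr s ms; have mrt := mr t mt.
apply: measurable_funD; apply: measurable_funM; [exact: mc| |exact: mc|].
  rewrite /integrand1; apply: measurable_funM; last exact: mdiff.
  apply: measurable_funM; last exact: mdiff.
  apply: measurable_funM; last by apply: measurable_funV; exact: mprod.
  apply: measurable_funD; last exact: mc.
  by apply: measurable_funM; exact: measurable_funD.
rewrite /integrand2; apply: measurable_funM; last exact: mprod.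
apply: measurable_funM; last exact: mdiff.
apply: measurable_funM; last exact: mdiff.
apply: measurable_funD.
  apply: measurable_funM.
    apply: measurable_funM.
      apply: measurable_funM; first exact: mc.
      by apply: mD4; exact: measurable_funD.
    by apply: measurable_funV; exact: measurable_funD.
  by apply: measurable_funB; apply: measurable_funM; auto.
apply: measurable_funM.
  apply: measurable_funM; first exact: mc.
  apply: mD4; apply: measurable_funD => //; apply: measurable_funD => //.
  exact: measurable_funD.
apply: measurable_funM.
  by apply: measurable_funB; apply: measurable_funM; auto.
by apply: measurable_funV; exact: measurable_funB.
Qed.

End Measurability.

Section Diagonal.
Context {R : realType}.
Local Notation mu := (@lebesgue_measure R).

(** Every vertical section of the diagonal is a single point. *)
Lemma diagonal_negligible : (mu \x mu)%E.-negligible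
  [set s : measurableTypeR R * measurableTypeR R | s.1 = s.2].
Proof.
have mD : measurable [set s : measurableTypeR R * measurableTypeR R | s.1 = s.2].
  have mB : measurable_fun [set: measurableTypeR R * measurableTypeR R]
      (fun s => s.1 - s.2 : R).
    apply: measurable_funB; move=> mT A mA.
      exact: (@measurable_fst _ _ (measurableTypeR R) (measurableTypeR R)).
    exact: (@measurable_snd _ _ (measurableTypeR R) (measurableTypeR R)).
  have := mB measurableT [set 0] (measurable_set1 0); rewrite setTI.
  congr measurable; apply/seteqP; split => s /=.
    by move/eqP; rewrite subr_eq0 => /eqP.
  by move=> ->; rewrite subrr.
exists [set s | s.1 = s.2]; split => //.
rewrite /product_measure1; apply: integral0_eq => x _ /=.
have -> : xsection [set s : measurableTypeR R * measurableTypeR R | s.1 = s.2] x = [set x].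
  by apply/seteqP; split => y; rewrite xsectionE /=.
exact: lebesgue_measure_set1.
Qed.

End Diagonal.

(** * Assembly of the second moment *)

Section SecondMoment.
Context d (T : measurableType d) (R : realType) (P : probability T R).
Variables (X Y : nat -> {RV P >-> R}) (m : nat).
Hypotheses (X_gauss : forall k, standard_gaussian (X k))
  (Y_gauss : forall k, standard_gaussian (Y k))
  (X_indep : mutually_independent X) (Y_indep : mutually_independent Y)
  (XY_indep : independent_sequences X Y).

Local Notation n := m.+1.
Local Notation K := (bridge_mx m : 'M[R]_m).
Local Notation mu := (@lebesgue_measure R).
Let B w := bform K (increments X w) (increments Y w).
Let QX w := bform K (increments X w) (increments X w).
Let QY w := bform K (increments Y w) (increments Y w).

Lemma theta_sqr w : theta X Y n w ^+ 2 = B w ^+ 2 / (QX w * QY w).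
Proof.
have cov (Z W : nat -> {RV P >-> R}) :
    empirical_cov n (fun i => walk Z i w) (fun i => walk W i w) =
    bform K (increments Z w) (increments W w).
  exact: (empirical_cov_walk m (fun j => Z j w) (fun j => W j w)).
rewrite /theta !cov expr_div_n exprMn !sqr_sqrtr //; exact: bridge_mx_psd.
Qed.

Let B_eq0X w : QX w = 0 -> B w = 0.
Proof.
rewrite /QX /B -(empirical_cov_walk m (fun j => X j w) (fun j => X j w)).
rewrite -(empirical_cov_walk m (fun j => X j w) (fun j => Y j w)).
exact: empirical_cov_eq0.
Qed.

Let B_eq0Y w : QY w = 0 -> B w = 0.
Proof.
have -> : B w = bform K (increments Y w) (increments X w).
  rewrite /B /bform exchange_big /=; apply: eq_bigr => j _; apply: eq_bigr => k _.
  by rewrite bridge_mx_sym (mulrC (increments X w k)).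
rewrite /QY -(empirical_cov_walk m (fun j => Y j w) (fun j => Y j w)).
rewrite -(empirical_cov_walk m (fun j => Y j w) (fun j => X j w)).
exact: empirical_cov_eq0.
Qed.

Let quadrant : set (measurableTypeR R * measurableTypeR R) :=
  [set s | 0 < s.1 /\ 0 < s.2]%R.

Lemma measurable_quadrant : measurable quadrant.
Proof.
have -> : quadrant = `]0, +oo[%classic `*` `]0, +oo[%classic.
  by apply/seteqP; split => s; rewrite /quadrant /= !in_itv /= !andbT.
by apply: measurableX; exact: measurable_itv.
Qed.

Lemma ratio_density_out s : ~ quadrant s -> ratio_density P B QX QY s = 0%E.
Proof.
move=> nqs; apply: integral0_eq => w _; rewrite /ratio_kernel /expweight /=.
case: (ltP 0 s.1) => s1; last by rewrite mul0r mul0r mulr0.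
case: (ltP 0 s.2) => s2; last by rewrite mul0r !mulr0.
by case: nqs.
Qed.

Lemma ratio_density_in s : quadrant s -> s.1 != s.2 ->
  ratio_density P B QX QY s = (second_moment_integrand n s.1 s.2)%:E.
Proof.
case: s => s t [/= s0 t0] st.
have N0 : 0 < n%:R :> R by rewrite ltr0Sn.
have [y1 _ _] := fP (divr_gt0 s0 N0); have [z1 _ _] := fP (divr_gt0 t0 N0).
have KX := bridge_moment m X_gauss X_indep y1.
have KY := bridge_moment m Y_gauss Y_indep z1.
have mX := mgf_bridge m X_gauss X_indep y1.
have mY := mgf_bridge m Y_gauss Y_indep z1.
move: KX KY mX mY; rewrite !bridge_paramK // => KX KY mX mY.
have [s0' t0'] := (ltW s0, ltW t0).
have E := integral_bform_sqr X_gauss Y_gauss XY_indep (@bridge_mx_sym R m)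
  (@bridge_mx_psd R m) s0' t0'.
have pX := @mgf_ge0 _ _ _ P X m K s; have pY := @mgf_ge0 _ _ _ P Y m K t.
rewrite -(second_moment_integrandE s0 t0 st pX pY mX mY).
rewrite /ratio_density.
transitivity (\int[P]_w ((4^-1)%:E * (B w ^+ 2 *
    (damping X K s w * damping Y K t w))%:E))%E.
  apply: eq_integral => w _; rewrite /ratio_kernel /expweight /= s0 t0 -EFinM.
  by rewrite !mul1r -mulrA.
have mB : measurable_fun [set: T] B.
  by apply: measurable_bform => j; exact: measurable_increment.
rewrite ge0_integralZl //.
- rewrite E KX KY -scalemxAl -scalemxAr !mxtraceZ -EFinM; congr (_%:E).
  by rewrite !mulrA.
- apply/measurable_EFinP; apply: measurable_funM; first exact: measurable_funX.
  by apply: measurable_funM; exact: measurable_damping.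
- move=> w _; rewrite lee_fin; apply: mulr_ge0; first exact: sqr_ge0.
  by apply: mulr_ge0; exact: damping_ge0.
Qed.

(** The density from Tonelli vanishes outside the quadrant and equals the closed form inside it off
    the diagonal, a null set. *)
Lemma second_moment :
  (\int[P]_w (theta X Y n w ^+ 2)%:E =
   \int[(mu \x mu)%E]_(s in quadrant) (second_moment_integrand n s.1 s.2)%:E)%E.
Proof.
have mq (Z W : nat -> {RV P >-> R}) : measurable_fun [set: T]
    (fun w => bform K (increments Z w) (increments W w)).
  by apply: measurable_bform => j; exact: measurable_increment.
under eq_integral do rewrite theta_sqr.
rewrite (@integral_ratio _ _ _ P B QX QY (mq X Y) (mq X X) (mq Y Y)
  (fun w => bridge_mx_psd _) (fun w => bridge_mx_psd _) B_eq0X B_eq0Y).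
rewrite [RHS]integral_mkcond; apply: ae_eq_integral => //.
- exact: (measurable_ratio_density P (mq X Y) (mq X X) (mq Y Y)).
- apply/(measurable_restrictT _ measurable_quadrant).
  apply/measurable_EFinP; apply: measurable_funTS.
  by apply: measurable_second_moment_integrand => mT A mA;
    [exact: (@measurable_fst _ _ (measurableTypeR R) (measurableTypeR R))
    |exact: (@measurable_snd _ _ (measurableTypeR R) (measurableTypeR R))].
- have [D [mD D0 sub]] := @diagonal_negligible R.
  exists D; split => // s /= H; apply: sub => /=; apply: contrapT => /eqP st.
  apply: H => _; rewrite patchE; case: ifPn => [/set_mem qs|/negP nqs].
    exact: ratio_density_in.
  by apply: ratio_density_out => qs; apply: nqs; exact: mem_set.
Qed.

End SecondMoment.

Theorem theorem3 (d : measure_display) (T : measurableType d) (R : realType)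
    (P : probability T R) (X Y : nat -> {RV P >-> R})
    (X_gauss : forall k : nat, standard_gaussian (X k))
    (Y_gauss : forall k : nat, standard_gaussian (Y k))
    (X_indep : mutually_independent X)
    (Y_indep : mutually_independent Y)
    (XY_indep : independent_sequences X Y)
    (n : nat) (n_ge2 : (2 <= n)%N) :
  ('E_P[(fun w : T => theta X Y n w ^+ 2)%R] =
   \int[lebesgue_measure \x lebesgue_measure]_(s in
       [set s : R * R | 0 < s.1 /\ 0 < s.2]%R)
     (second_moment_integrand n s.1 s.2)%:E)%E.
Proof.
case: n n_ge2 => [//|m] _.
rewrite unlock.
exact: second_moment.
Qed.
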